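(* (i) For $\lambda_0,\lambda_1>0$ with $\lambda_0+\lambda_1<1$, let $K\subset\mathbb{R}$ be the attractor of the self-similar IFS $\{\varphi_0(x)=\lambda_0x,\ \varphi_1(x)=\lambda_1x+1-\lambda_1\}$. If $\log\lambda_0/\log\lambda_1\notin\mathbb{Q}$, then for any $m\in\mathbb{N}$ and any vector $\boldsymbol{t}=(t_0,t_1,\ldots,t_m)\in\mathbb{R}^{m+1}$ with $0=t_0<t_1<\cdots<t_m$, the union $K_{\boldsymbol{t}}=\bigcup_{j=0}^m(K+t_j)$ is not a self-similar set. (ii) For $0<\lambda<1/3$ and $\lambda<\zeta<1-2\lambda$, let $K\subset\mathbb{R}$ be the attractor of the self-similar IFS $\{\varphi_0(x)=\lambda x,\ \varphi_1(x)=\lambda x+\zeta,\ \varphi_2(x)=\lambda x+1-\lambda\}$. If $\zeta\notin\mathbb{Q}(\lambda)$, then for any $t>0$, the union $K\cup(K+t)$ is not a self-similar set.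
   Context: $\mathbb{N}=\{1,2,\ldots\}$; $\mathbb{Q}(\lambda)$ is the subfield of $\mathbb{R}$ generated by $\lambda$ over $\mathbb{Q}$. A self-similar IFS on $\mathbb{R}$ is a finite set of maps $f_i(x)=\lambda_i x+a_i$ with $0<|\lambda_i|<1$, $a_i\in\mathbb{R}$; its attractor is the unique non-empty compact set $K\subset\mathbb{R}$ with $K=\bigcup_i f_i(K)$. A self-similar set is the attractor of some self-similar IFS; self-similar sets are always assumed to be non-singletons. *)

(* Defs.v *)
From HB Require Import structures.
From mathcomp Require Import all_boot all_order all_algebra.
From mathcomp Require Import all_classical all_reals all_analysis.
Set Implicit Arguments.
Unset Strict Implicit.
Unset Printing Implicit Defensive.
Import Order.TTheory GRing.Theory Num.Theory.
Import numFieldNormedType.Exports.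
Local Open Scope classical_set_scope.
Local Open Scope ring_scope.

(* The pair (l, a) encodes the map x |-> l * x + a, and a finite set of maps is
   encoded by a list of pairs; repetitions and order do not affect attractors. *)
Definition affine_map (R : realType) (f : R * R) (x : R) : R := f.1 * x + f.2.

Definition is_self_similar_ifs (R : realType) (s : seq (R * R)) : Prop :=
  forall f, f \in s -> 0 < `|f.1| < 1.

(* For s a self-similar IFS such a K exists and is unique (Hutchinson), except
   that there is none for the empty list: the equation would force K = set0. *)
Definition is_attractor (R : realType) (s : seq (R * R)) (K : set R) : Prop :=
  [/\ K !=set0, compact K &
      K = \bigcup_(f in [set` s]) (affine_map f @` K)].

Definition self_similar_set (R : realType) (K : set R) : Prop :=
  (exists s : seq (R * R), is_self_similar_ifs s /\ is_attractor s K) /\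
  ~ (exists x : R, K = [set x]).

Definition translate (R : realType) (K : set R) (t : R) : set R :=
  [set x + t | x in K].

(* The field Q(x); since 0^-1 = 0, the subfields of R are exactly the sets
   containing 1 and closed under subtraction and division. *)
Definition Qadjoin (R : realType) (x : R) : set R :=
  smallest [set F : set R | divring_closed (mem F)] (@rational R `|` [set x]).

(* Main.v *)
Require Import Defs.
From HB Require Import structures.
From mathcomp Require Import all_boot all_order all_algebra.
From mathcomp Require Import all_classical all_reals all_analysis.
From mathcomp Require Import zify ring lra.
Set Implicit Arguments.
Unset Strict Implicit.
Unset Printing Implicit Defensive.
Import Order.TTheory GRing.Theory Num.Theory.
Import numFieldNormedType.Exports.
Local Open Scope classical_set_scope.
Local Open Scope ring_scope.

(** Why the theorem is true.

    Part (i).  Let X be the union.  Some map of an iterated function system of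
    X covers the left end of X and some map covers the right end; composing
    these two when both reverse the orientation, one obtains a homothety with
    ratio r in ]0, 1[, centred at an end of X, that maps X into itself
    ([self_similar_end_scaling]).  Up to a reflection the centre is 0.  A power
    of the homothety carries X into the part of X next to 0, which belongs to
    K; so K contains rK and rK + r t_1 for some small r.  Zooming into K shows
    that every orientation preserving copy of K inside K is a cylinder
    ([two_maps_embedding]): a copy that lies in no first-level cylinder
    straddles the gap of K, and the gaps of a copy with ratio r are too short
    for that unless r = 1.  The cylinder rK contains 0, so r is a power of l0;
    the cylinder rK + r t_1 does not, so r is also a product of powers of l0
    and l1 in which l1 occurs.  This makes ln l0 / ln l1 rational.

    Part (ii).  Words w over three letters code the left ends val w of the
    cylinders of K.  Call the quotient b / a the ratio of a gap ]a, b[.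

    The largest gap ratio of K differs from that of its mirror image 1 - K, as
    z is not the midpoint (1 - l) / 2.  By a reflection it may be assumed to be
    larger for K, and then no homothetic image of 1 - K has its germ at 0
    contained in K ([max_gap_ratio_chiral]).  The gap ratios also show that
    sK is contained in K only when s is a power of l ([self_scaling_expr]).
    Looking at K through a microscope at a left end, one gets
    [covering_left_end]: an affine map of K into K whose image contains a left
    end has a power of l as its ratio, and its preimage of the left end is a
    left end.

    Applied at the left end 0 of X = K + {0, t}, this shows that l^q X is
    contained in K for some q.  A copy l^N K + c inside K is always a cylinder
    of level N ([embedding_offset]).  Indeed it contains a left end, by a
    counting argument: choose a cylinder of K that contains as many pieces of
    the copy, of a fixed relative level, as possible; each subcylinder must
    then contain just as many, so the copy is dense in that cylinder.  The
    same applies to every piece of the copy, and the digits can be compared,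
    because z is not in Q(l) and l < 1/3: a sum of two values val a + val b
    determines the sum of the digits at each position ([val_sum_digits]).

    So, with q minimal, l^q X is the union of the cylinders of 0...0 and of a
    word u of length q that starts with a letter d <> 0 ([union_normal_form]).
    A map of the iterated function system that covers a left end has ratio
    l^n, and carries l^q X to two cylinders whose words w0, w1 agree before
    position n and have the letters 0 and d there ([map_digits]).  Take the
    left end coded by 0^q e^k where e is the letter other than 0 and d, and k
    is so large that n < k for all maps.  Its word must start with w0 or w1.
    If q <= n, its letter at position n is e, which is neither 0 nor d.  If
    n < q, then w1 starts with 0^n d, and the cylinder of w1 lies outside of
    l^q X ([second_copy_position]). *)

(** * Attractors, their ends and their mirror images *)

Definition maps_into (R : realType) (r c : R) (A B : set R) : Prop :=
  forall x, A x -> B (r * x + c).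

Definition mirror (R : realType) (c : R) (A : set R) : set R :=
  [set c - x | x in A].

Definition avoids (R : realType) (A : set R) (a b : R) : Prop :=
  forall x, a < x < b -> ~ A x.

Section Attractors.
Context {R : realType}.
Implicit Types (K X : set R) (s : seq (R * R)).

Lemma compact_least K : K !=set0 -> compact K ->
  exists2 m, K m & forall x, K x -> m <= x.
Proof.
move=> K0 cK; have [m mK mle] := compact_EVT_min K0 cK
  (@continuous_subspaceT _ _ _ idfun (fun x => @cvg_id _ (nbhs x))).
by exists m => [|x Kx]; [rewrite inE in mK|apply: mle; rewrite inE].
Qed.

Lemma compact_greatest K : K !=set0 -> compact K ->
  exists2 m, K m & forall x, K x -> x <= m.
Proof.
move=> K0 cK; have [m mK mle] := compact_EVT_max K0 cK
  (@continuous_subspaceT _ _ _ idfun (fun x => @cvg_id _ (nbhs x))).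
by exists m => [|x Kx]; [rewrite inE in mK|apply: mle; rewrite inE].
Qed.

Lemma attractor_sub s K : is_attractor s K ->
  forall f, f \in s -> maps_into f.1 f.2 K K.
Proof.
move=> [_ _ KE] f fs x Kx; rewrite KE; exists f => //.
by exists x.
Qed.

Lemma attractor_cover s K : is_attractor s K -> forall x, K x ->
  exists f y, [/\ f \in s, K y & x = f.1 * y + f.2].
Proof.
move=> [_ _ KE] x; rewrite {1}KE => -[f fs [y Ky <-]].
by exists f, y.
Qed.

Lemma mirrorE c K x : mirror c K x <-> K (c - x).
Proof.
by split=> [[y Ky <-]|Kx]; [rewrite subKr|exists (c - x) => //; rewrite subKr].
Qed.

(** Conjugating x |-> r x + b by x |-> c - x keeps the ratio r and only changes
    the offset; so the mirror image of a self-similar set is self-similar. *)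
Lemma mirror_attractor c s K : is_attractor s K ->
  is_attractor [seq (f.1, c - f.1 * c - f.2) | f <- s] (mirror c K).
Proof.
move=> aK; have [[x0 Kx0] cK _] := aK; split.
- by exists (c - x0); exists x0.
- apply: continuous_compact => //; apply: continuous_subspaceT => x.
  by apply: cvgB; [exact: cvg_cst|exact: cvg_id].
- apply/seteqP; split=> [_ [x Kx <-]|x [f]].
    have [f [y [fs Ky ->]]] := attractor_cover aK Kx.
    exists (f.1, c - f.1 * c - f.2); first by apply/mapP; exists f.
    by exists (c - y); [exists y|rewrite /affine_map /=; ring].
  move=> /mapP[g gs ->] [_ [y Ky <-] <-] {x}.
  exists (g.1 * y + g.2); first exact: (attractor_sub aK).
  by rewrite /affine_map /=; ring.
Qed.

(** The maps send [0, 1] into itself, so the least element of K cannot be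
    negative, and it cannot be positive as x |-> a x would decrease it; likewise
    at the other end. *)
Lemma attractor_hull s K (a b : R) :
    (forall f, f \in s -> [/\ 0 < f.1 < 1, 0 <= f.2 & f.1 + f.2 <= 1]) ->
    (a, 0) \in s -> (b, 1 - b) \in s -> is_attractor s K ->
  [/\ K 0, K 1 & forall x, K x -> 0 <= x <= 1].
Proof.
move=> sP sa sb aK; have [K0 cK _] := aK.
have [m Km mP] := compact_least K0 cK.
have [M KM MP] := compact_greatest K0 cK.
have /sP[/= /andP[a0 a1] _ _] := sa; have /sP[/= /andP[b0 b1] _ _] := sb.
have m0 : 0 <= m.
  have [f [y [fs Ky mE]]] := attractor_cover aK Km.
  have [/andP[f0 f1] f2 _] := sP _ fs; have := mP _ Ky; nra.
have M1 : M <= 1.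
  have [f [y [fs Ky ME]]] := attractor_cover aK KM.
  have [/andP[f0 f1] _ f2] := sP _ fs; have := MP _ Ky; nra.
have m00 : m = 0.
  have := mP _ (attractor_sub aK sa Km); rewrite /=; nra.
have M11 : M = 1.
  have := MP _ (attractor_sub aK sb KM); rewrite /=; nra.
split; [by rewrite -m00|by rewrite -M11|move=> x Kx].
by rewrite (le_trans m0 (mP _ Kx)) (le_trans (MP _ Kx) M1).
Qed.

End Attractors.

Lemma expr_small {R : realType} (q e : R) :
  0 < q < 1 -> 0 < e -> exists n, q ^+ n < e.
Proof.
move=> /andP[q0 q1] e0.
have qlt1 : `|q| < 1 by rewrite gtr0_norm.
have /cvgrPdist_lt/(_ e e0)[N _ /(_ N (leqnn N))] := cvg_expr qlt1.
by rewrite /= sub0r normrN gtr0_norm ?exprn_gt0 // => ?; exists N.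
Qed.

Lemma maps_into_iter {R : realType} (r : R) X n :
  maps_into r 0 X X -> maps_into (r ^+ n) 0 X X.
Proof.
move=> rX; elim: n => [|n IH] x Xx; first by rewrite expr0 mul1r addr0.
by have := rX _ (IH _ Xx); rewrite !addr0 exprS mulrA.
Qed.

Lemma attractor_eq_mem {R : realType} (s s' : seq (R * R)) K :
  s =i s' -> is_attractor s K -> is_attractor s' K.
Proof.
move=> ss' [K0 cK KE]; split=> //; rewrite {1}KE; congr (\bigcup_(i in _) _).
by apply/seteqP; split=> f /=; rewrite ss'.
Qed.

(** A map that covers an end of X without reversing the orientation fixes that
    end.  If the maps covering the two ends both reverse the orientation, they
    exchange the two ends, and their composite fixes the left one. *)
Lemma self_similar_end_scaling {R : realType} s (X : set R) M :
    is_self_similar_ifs s -> is_attractor s X -> X 0 -> X M ->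
    (forall x, X x -> 0 <= x <= M) ->
  exists2 r, 0 < r < 1 &
    maps_into r 0 X X \/ maps_into r 0 (mirror M X) (mirror M X).
Proof.
move=> sP aX X0 XM XB.
have fXB f x : f \in s -> X x -> 0 <= f.1 * x + f.2 <= M.
  by move=> fs /(attractor_sub aX fs)/XB.
have [f [y [fs Xy fy]]] := attractor_cover aX X0.
have [f0|f0] := ltP 0 f.1.
  have f1 : f.1 < 1 by have := sP _ fs; rewrite gtr0_norm // => /andP[].
  have f20 : f.2 = 0.
    by have /andP[h _] := fXB _ _ fs X0; have /andP[yB _] := XB _ Xy; nra.
  exists f.1; first by rewrite f0.
  by left=> x /(attractor_sub aX fs); rewrite f20.
have [g [z [gs Xz gz]]] := attractor_cover aX XM.
have [g0|g0] := ltP 0 g.1.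
  have g1 : g.1 < 1 by have := sP _ gs; rewrite gtr0_norm // => /andP[].
  have g2M : g.2 = M - g.1 * M.
    by have /andP[_ h] := fXB _ _ gs XM; have /andP[_ zB] := XB _ Xz; nra.
  exists g.1; first by rewrite g0.
  right=> x /mirrorE /(attractor_sub aX gs) Xx; apply/mirrorE.
  by congr X: Xx; rewrite g2M; ring.
have f2 : f.2 = - f.1 * M.
  by have /andP[h _] := fXB _ _ fs XM; have /andP[_ yB] := XB _ Xy; nra.
have g2 : g.2 = M.
  by have /andP[_ h] := fXB _ _ gs X0; have /andP[zB _] := XB _ Xz; nra.
have := sP _ fs; have := sP _ gs; rewrite !ler0_norm // => gB fB.
exists (f.1 * g.1); first by apply/andP; split; nra.
left=> x /(attractor_sub aX gs) /(attractor_sub aX fs) Xx.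
by congr X: Xx; rewrite f2 g2; ring.
Qed.

(** * Cantor sets generated by two maps *)

Section TwoMaps.
Context {R : realType} (l0 l1 : R) (K : set R).
Hypotheses (l0_gt0 : 0 < l0) (l1_gt0 : 0 < l1) (l01_lt1 : l0 + l1 < 1).
Hypothesis aK : is_attractor [:: (l0, 0); (l1, 1 - l1)] K.

Local Ltac recall_bounds :=
  have l0p := l0_gt0; have l1p := l1_gt0; have l01p := l01_lt1.

Let hull : [/\ K 0, K 1 & forall x, K x -> 0 <= x <= 1].
Proof.
recall_bounds; apply: (@attractor_hull _ [:: (l0, 0); (l1, 1 - l1)] K l0 l1) => //.
- by move=> f; rewrite !inE => /orP[]/eqP->/=; split; lra.
- by rewrite !inE eqxx.
- by rewrite !inE eqxx orbT.
Qed.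

Let K0 : K 0. Proof. by case: hull. Qed.
Let K1 : K 1. Proof. by case: hull. Qed.
Let K01 x : K x -> 0 <= x <= 1. Proof. by case: hull => _ _; apply. Qed.

Let Kl0 x : K x -> K (l0 * x).
Proof.
move=> Kx; have := attractor_sub aK (f := (l0, 0)) _ Kx.
by rewrite addr0; apply; rewrite inE eqxx.
Qed.

Let Kl1 x : K x -> K (l1 * x + (1 - l1)).
Proof.
move=> Kx; have := attractor_sub aK (f := (l1, 1 - l1)) _ Kx.
by apply; rewrite !inE eqxx orbT.
Qed.

Let Kcover x : K x -> exists2 y, K y & x = l0 * y \/ x = l1 * y + (1 - l1).
Proof.
move=> Kx; have [f [y [fs Ky ->]]] := attractor_cover aK Kx.
exists y => //; move: fs; rewrite !inE => /orP[]/eqP->; [left|right] => //=.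
by rewrite addr0.
Qed.

Let q := l0 + l1.
Let q01 : 0 < q < 1. Proof. recall_bounds; rewrite /q; lra. Qed.

(** The middle gap is the longest one: an interval that avoids K lies in the
    middle gap or, up to zooming into a cylinder, is a shorter such interval. *)
Lemma two_maps_gap_le (a b : R) : 0 <= a -> b <= 1 ->
  avoids K a b -> b - a <= 1 - l0 - l1.
Proof.
recall_bounds; move=> a0 b1 abK; have [ab|ba] := ltP a b; last by lra.
have [n /ltW] := @expr_small _ q (b - a) q01 ltac:(lra).
elim: n a b a0 b1 abK {ab} => [|n IH] a b a0 b1 abK qn.
  have [] := abK (l0 * 1) _ (Kl0 K1).
  move: qn; rewrite expr0 => qn; apply/andP; split; lra.
have qpos : 0 < q ^+ n by rewrite exprn_gt0 //; move: q01; lra.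
have zoom l c : 0 < l <= q -> (forall x, K x -> K (l * x + c)) ->
    c <= a -> b <= c + l -> b - a <= 1 - l0 - l1.
  move=> /andP[lp lq] Kl ca bc.
  have aE : a = l * ((a - c) / l) + c by field; lra.
  have bE : b = l * ((b - c) / l) + c by field; lra.
  set a' := (a - c) / l in aE; set b' := (b - c) / l in bE.
  have gt0 : 0 <= a' by rewrite /a' divr_ge0 //; lra.
  have le1 : b' <= 1 by rewrite /b' ler_pdivrMr //; lra.
  have h : b' - a' <= 1 - l0 - l1.
    apply: IH => //.
      move=> x /andP[ax xb] /Kl; apply: abK.
      by rewrite {1}aE bE !ltrD2r !ltr_pM2l // ax.
    by move: qn; rewrite exprS; nra.
  by move: q01 => /andP[_ ql]; nra.
have [bl|lb] := leP b l0.
  by apply: (zoom l0 0); [rewrite /q; lra|move=> x Kx; rewrite addr0; exact: Kl0| |]; lra.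
have la : l0 <= a.
  rewrite leNgt; apply/negP => al; have [] := abK (l0 * 1) _ (Kl0 K1); lra.
have [bl|lb'] := leP b (1 - l1); first lra.
have la' : 1 - l1 <= a.
  rewrite leNgt; apply/negP => al; have [] := abK (l1 * 0 + (1 - l1)) _ (Kl1 K0); lra.
by apply: (zoom l1 (1 - l1)); [rewrite /q; lra|exact: Kl1| |]; lra.
Qed.

(** Only the ratio and the question whether the copy starts at 0 are recorded of
    the cylinder that the copy must be. *)
Lemma two_maps_embedding (r c : R) : 0 < r -> maps_into r c K K ->
  exists i j, r = l0 ^+ i * l1 ^+ j /\ (j = 0%N <-> c = 0).
Proof.
recall_bounds; move=> r0; have [n /ltW] := @expr_small _ q r q01 r0.
elim: n r c r0 => [|n IH] r c r0 qr rK.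
  have := K01 (rK _ K0); have := K01 (rK _ K1).
  rewrite expr0 in qr; move=> h1 h2.
  have -> : c = 0 by lra.
  have -> : r = 1 by lra.
  by exists 0%N, 0%N; rewrite !expr0 mulr1.
have qpos : 0 < q ^+ n by rewrite exprn_gt0 //; move: q01; lra.
have c0 := K01 (rK _ K0); have c1 := K01 (rK _ K1).
have [rc|rc] := leP (r + c) l0.
  have rE : r = l0 * (r / l0) by field; lra.
  have cE : c = l0 * (c / l0) by field; lra.
  set r' := r / l0 in rE; set c' := c / l0 in cE.
  have rp : 0 < r' by rewrite divr_gt0.
  have [|||i [j [r'E jc]]] := IH r' c' => //.
  - by move: qr; rewrite exprS /q; nra.
  - move=> x Kx; have [y Ky [yE|yE]] := Kcover (rK _ Kx).
      suff -> : r' * x + c' = y by [].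
      apply: (mulfI (_ : l0 != 0)); first by rewrite gt_eqF.
      by rewrite -yE mulrDr mulrA -rE -cE.
    by have := K01 Kx; have := K01 Ky; nra.
  exists i.+1, j; split; first by rewrite rE r'E exprS mulrA.
  rewrite jc cE; split=> [->|/eqP]; first by rewrite mulr0.
  by rewrite mulf_eq0 (gt_eqF l0_gt0) => /eqP.
have [lc|lc] := leP (1 - l1) c.
  have rE : r = l1 * (r / l1) by field; lra.
  have cE : c = l1 * ((c - (1 - l1)) / l1) + (1 - l1) by field; lra.
  set r' := r / l1 in rE; set c' := (c - (1 - l1)) / l1 in cE.
  have rp : 0 < r' by rewrite divr_gt0.
  have [|||i [j [r'E jc]]] := IH r' c' => //.
  - by move: qr; rewrite exprS /q; nra.
  - move=> x Kx; have [y Ky [yE|yE]] := Kcover (rK _ Kx).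
      by have := K01 Kx; have := K01 Ky; nra.
    suff -> : r' * x + c' = y by [].
    apply: (mulfI (_ : l1 != 0)); first by rewrite gt_eqF.
    by apply: (addIr (1 - l1)); rewrite -yE rE cE; ring.
  exists i, j.+1; split; first by rewrite rE r'E exprS; ring.
  by split=> // cc; exfalso; lra.
(* The copy straddles the gap of K, which therefore lies in a gap of the copy;
   the gaps of the copy are at most r times as long as that of K. *)
have cl : c <= l0.
  have [y Ky [yE|yE]] := Kcover (rK _ K0); have := K01 Ky; nra.
have cr : 1 - l1 <= r + c.
  have [y Ky [yE|yE]] := Kcover (rK _ K1); have := K01 Ky; nra.
have r1 : 1 <= r.
  have h : (1 - l1 - c) / r - (l0 - c) / r <= 1 - l0 - l1.
    apply: two_maps_gap_le.
    - by rewrite divr_ge0 //; lra.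
    - by rewrite ler_pdivrMr //; lra.
    move=> x; rewrite ltr_pdivlMr // ltr_pdivrMr // => xr Kx.
    have [y Ky [yE|yE]] := Kcover (rK _ Kx); have := K01 Ky; nra.
  rewrite -mulrBl ler_pdivrMr // in h.
  nra.
have -> : c = 0 by lra.
have -> : r = 1 by lra.
by exists 0%N, 0%N; rewrite !expr0 mulr1.
Qed.

Lemma irrational_ratio_expr :
    ~ rational (ln l0 / ln l1) ->
  forall i i' j, l0 ^+ i = l0 ^+ i' * l1 ^+ j -> j = 0%N.
Proof.
recall_bounds; move=> irr i i' j E; have [//|j0] := eqVneq j 0%N; case: irr.
have ln1 : ln l1 < 0 by apply: ln_lt0; lra.
have ln0 : ln l0 < 0 by apply: ln_lt0; lra.
have lE : ln l0 * i%:R = ln l0 * i'%:R + ln l1 * j%:R.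
  rewrite !mulr_natr -!lnXn // -lnM ?posrE ?exprn_gt0 //.
  by rewrite E.
apply/rationalP.
have jE : ln l0 * (i%:R - i'%:R) = ln l1 * j%:R by rewrite mulrBr lE; ring.
have jn0 : j%:R != 0 :> R by rewrite pnatr_eq0.
have il : (i' < i)%N.
  rewrite -(@ltr_nat R) -subr_gt0 -(nmulr_rlt0 _ ln0) jE.
  by rewrite nmulr_rlt0 // ltr0n lt0n.
exists (j : int), (i - i')%N; rewrite natrB ?(ltnW il) // pmulrn.
apply/eqP; rewrite eqr_div ?(lt_eqF ln1) // ?subr_eq0 ?eqr_nat ?(gtn_eqF il) //.
by rewrite jE mulrC.
Qed.

(** A power r of the given ratio brings X into the part near 0, so that K contains
    both rK and rK + r t.  The former contains 0 and forces r to be a power of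
    l0; the latter then forces r t = 0 by irrationality. *)
Lemma two_maps_not_scaled X (r t : R) :
    ~ rational (ln l0 / ln l1) -> 0 < r < 1 -> 0 < t ->
    (forall x, K x -> X x) -> (forall x, K x -> X (x + t)) ->
    (exists M, forall x, X x -> x <= M) ->
    (exists2 e, 0 < e & forall x, X x -> x < e -> K x) ->
  ~ maps_into r 0 X X.
Proof.
recall_bounds; move=> irr r01 t0 KX KtX [M XM] [e e0 XeK] rX.
have M0 : 0 < M.
  by have := XM _ (KtX _ K0); lra.
have [n rn] := @expr_small _ r (e / M) r01 (divr_gt0 e0 M0).
rewrite ltr_pdivlMr // in rn.
have s0 : 0 < r ^+ n by rewrite exprn_gt0 //; case/andP: r01.
have sX x : X x -> K (r ^+ n * x).
  move=> Xx; apply: XeK; first by have := maps_into_iter n rX Xx; rewrite addr0.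
  by apply: le_lt_trans rn; rewrite ler_pM2l // XM.
have [|i [j [sE [_ j0]]]] := two_maps_embedding (c := 0) s0.
  by move=> x /KX/sX; rewrite addr0.
have [|i' [j' [sE' [c0 _]]]] := two_maps_embedding (c := r ^+ n * t) s0.
  by move=> x /KtX/sX; rewrite mulrDr.
move: sE; rewrite j0 // expr0 mulr1 => sE.
have := c0 (irrational_ratio_expr irr (etrans (esym sE) sE')).
by apply/eqP; rewrite gt_eqF // mulr_gt0.
Qed.

End TwoMaps.

Lemma rationalV {R : realType} (x : R) : rational x -> rational x^-1.
Proof. by case=> q _ <-; exists q^-1 => //; rewrite fmorphV. Qed.

Lemma two_maps_translates_not_self_similar {R : realType} (l0 l1 : R) (K : set R)
    (m : nat) (t : 'rV[R]_m.+1) :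
  0 < l0 -> 0 < l1 -> l0 + l1 < 1 ->
  is_attractor [:: (l0, 0); (l1, 1 - l1)] K ->
  ~ rational (ln l0 / ln l1) ->
  (1 <= m)%N -> t ord0 ord0 = 0 ->
  (forall i j : 'I_m.+1, (i < j)%N -> t ord0 i < t ord0 j) ->
  ~ self_similar_set (\bigcup_(j in [set: 'I_m.+1]) translate K (t ord0 j)).
Proof.
move=> l0p l1p l01 aK irr m1 t0 tmono [[s [sP aX]] _].
set X := \bigcup_(j in _) _ in aX.
have tle (i j : 'I_m.+1) : (i <= j)%N -> t ord0 i <= t ord0 j.
  rewrite leq_eqVlt => /orP[/eqP/val_inj->//|/tmono/ltW//].
have [K0 K1 KB] : [/\ K 0, K 1 & forall x, K x -> 0 <= x <= 1].
  apply: (@attractor_hull _ _ K l0 l1 _ _ _ aK).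
  - by move=> f; rewrite !inE => /orP[]/eqP->/=; split; lra.
  - by rewrite inE eqxx.
  - by rewrite !inE eqxx orbT.
have KX j x : K x -> X (x + t ord0 j) by move=> Kx; exists j => //; exists x.
have XK x : X x -> exists j y, K y /\ x = y + t ord0 j.
  by move=> [j _ [y Ky <-]]; exists j, y.
pose M := 1 + t ord0 ord_max.
have XB x : X x -> 0 <= x <= M.
  move=> /XK[j [y [Ky ->]]]; have := KB _ Ky.
  have := tle ord0 j isT; have := tle j ord_max (leq_ord j).
  by rewrite t0 /M => ? ? ?; apply/andP; split; lra.
have X0 : X 0 by have := KX ord0 0 K0; rewrite t0 addr0.
have [r r01 [rX|rX]] := self_similar_end_scaling sP aX X0 (KX ord_max 1 K1) XB.
  have i1 : (inord 1 : 'I_m.+1) = 1%N :> nat by rewrite inordK.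
  have t1 : 0 < t ord0 (inord 1) by rewrite -t0 tmono // i1.
  apply: (two_maps_not_scaled l0p l1p l01 aK irr r01 t1 _ (KX _) _ _ rX).
  - by move=> x /(KX ord0); rewrite t0 addr0.
  - by exists M => x /XB/andP[].
  - exists (t ord0 (inord 1)) => // x /XK[j [y [Ky ->]]] xt.
    have [j0|j0] := posnP j.
      have -> : j = ord0 by exact: val_inj.
      by rewrite t0 addr0.
    have := tle (inord 1) j; rewrite i1 => /(_ j0); have := KB _ Ky; lra.
have im : (inord m.-1 : 'I_m.+1) = m.-1 :> nat by rewrite inordK // ltnS leq_pred.
have t1 : 0 < t ord0 ord_max - t ord0 (inord m.-1).
  by rewrite subr_gt0 tmono // im /= prednK.
have irr' : ~ rational (ln l1 / ln l0).
  by move=> /rationalV; rewrite invf_div.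
have aK' : is_attractor [:: (l1, 0); (l0, 1 - l0)] (mirror 1 K).
  apply: attractor_eq_mem (mirror_attractor 1 aK) => f /=.
  have -> : 1 - l0 * 1 - 0 = 1 - l0 by ring.
  have -> : 1 - l1 * 1 - (1 - l1) = 0 by ring.
  by rewrite !inE orbC.
apply: (two_maps_not_scaled l1p l0p _ aK' irr' r01 t1 _ _ _ _ rX).
- by rewrite addrC.
- move=> x /mirrorE/(KX ord_max) Xx; apply/mirrorE; congr X: Xx; rewrite /M; ring.
- move=> x /mirrorE/(KX (inord m.-1)) Xx; apply/mirrorE; congr X: Xx; rewrite /M; ring.
- by exists M => x /mirrorE/XB/andP[]; rewrite subr_ge0.
- exists (t ord0 ord_max - t ord0 (inord m.-1)) => // x /mirrorE/XK[j [y [Ky xE]]] xt.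
  apply/mirrorE; have [j0|j0] := eqVneq (j : nat) m.
    have jE : j = ord_max by exact: val_inj.
    by move: xE; rewrite jE /M => xE; have -> : 1 - x = y by lra.
  have := tle j (inord m.-1); rewrite im -ltnS prednK // ltn_neqAle j0 leq_ord.
  by move=> /(_ isT); have := KB _ Ky; rewrite /M in xE; lra.
Qed.

(** * Cantor sets generated by three maps: gaps *)

(** The letters None, Some false, Some true stand for 0, 1, 2, so that None, the
    default value of [nth None], pads words by zeros: trailing zeros do not
    change the left end of the cylinder that a word codes. *)
Definition letter := option bool.

Definition digit {R : realType} (l z : R) (e : letter) : R :=
  match e with None => 0 | Some false => z | Some true => 1 - l end.

Section ThreeMaps.
Context {R : realType} (l z : R) (K : set R).
Hypotheses (l_gt0 : 0 < l) (l_lt3 : l < 1 / 3) (l_ltz : l < z).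
Hypothesis (z_lt : z < 1 - 2 * l).
Hypothesis aK : is_attractor [:: (l, 0); (l, z); (l, 1 - l)] K.

Local Ltac recall_bounds :=
  have lp := l_gt0; have l3 := l_lt3; have lz := l_ltz; have z1 := z_lt.

Let hull : [/\ K 0, K 1 & forall x, K x -> 0 <= x <= 1].
Proof.
recall_bounds; apply: (@attractor_hull _ _ K l l _ _ _ aK).
- by move=> f; rewrite !inE => /or3P[]/eqP->/=; split; lra.
- by rewrite inE eqxx.
- by rewrite !inE eqxx !orbT.
Qed.

Let K0 : K 0. Proof. by case: hull. Qed.
Let K1 : K 1. Proof. by case: hull. Qed.
Let K01 x : K x -> 0 <= x <= 1. Proof. by case: hull => _ _; apply. Qed.

Lemma K_digit e x : K x -> K (digit l z e + l * x).
Proof.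
move=> Kx; rewrite addrC.
by apply: (attractor_sub aK (f := (l, digit l z e))) => //; case: e => [[]|];
  rewrite !inE eqxx ?orbT.
Qed.

Lemma K_cover x : K x -> exists e y, K y /\ x = digit l z e + l * y.
Proof.
move=> Kx; have [f [y [fs Ky ->]]] := attractor_cover aK Kx.
move: fs; rewrite !inE => /or3P[]/eqP->/=;
  [exists None|exists (Some false)|exists (Some true)];
  by exists y; split=> //; rewrite addrC.
Qed.

Lemma K_unscale x : K x -> x < z -> K (x / l).
Proof.
recall_bounds; move=> Kx xz; have [e [y [Ky xE]]] := K_cover Kx.
have yB := K01 Ky.
suff -> : x / l = y by [].
case: e xE => [[]|] /= xE; [exfalso; nra..|].
by rewrite xE add0r mulrAC mulfV ?mul1r // gt_eqF.
Qed.

Lemma avoids_point a b x : avoids K a b -> K x -> b <= x \/ x <= a.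
Proof.
move=> ab Kx; have [|xb] := leP b x; [by left|right].
by rewrite leNgt; apply/negP => ax; apply: ab Kx; rewrite ax.
Qed.

Lemma avoids_zoom e a b : avoids K a b ->
  avoids K ((a - digit l z e) / l) ((b - digit l z e) / l).
Proof.
recall_bounds; move=> ab x; rewrite ltr_pdivrMr // ltr_pdivlMr // => xab.
by move/(K_digit e); apply: ab; lra.
Qed.

Lemma avoids_position a b : avoids K a b -> a < b -> 0 <= a -> b <= 1 ->
  [\/ l <= a /\ b <= z, z + l <= a /\ b <= 1 - l |
      exists e, digit l z e <= a /\ b <= digit l z e + l].
Proof.
recall_bounds; move=> ab altb a0 b1.
have lE := avoids_point ab (K_digit None K1).
have zE := avoids_point ab (K_digit (Some false) K0).
have zlE := avoids_point ab (K_digit (Some false) K1).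
have rE := avoids_point ab (K_digit (Some true) K0).
rewrite /= ?mulr0 ?mulr1 ?addr0 ?add0r in lE zE zlE rE.
case: lE => lE; first by apply: Or33; exists None => /=; lra.
case: zE => zE; first by apply: Or31.
case: zlE => zlE; first by apply: Or33; exists (Some false) => /=; lra.
case: rE => rE; first by apply: Or32.
by apply: Or33; exists (Some true) => /=; lra.
Qed.

(** Any common bound [G] of the two main gaps bounds all gaps, because the others
    are contractions of these two. *)
Lemma avoids_length G a b : z - l <= G -> 1 - 2 * l - z <= G ->
  avoids K a b -> 0 <= a -> b <= 1 -> b - a <= G.
Proof.
recall_bounds; move=> G1 G2 ab a0 b1; have [altb|ba] := ltP a b; last by lra.
have [n /ltW] := @expr_small _ l (b - a) ltac:(lra) ltac:(lra).
elim: n a b ab a0 b1 altb => [|n IH] a b ab a0 b1 altb ln.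
  have := avoids_point ab (K_digit None K1); rewrite expr0 in ln.
  by rewrite /=; lra.
have lnp : 0 < l ^+ n by rewrite exprn_gt0.
have [[? ?]|[? ?]|[e [ea be]]] := avoids_position ab altb a0 b1; [lra|lra|].
have := IH _ _ (avoids_zoom (e := e) ab).
rewrite divr_ge0 ?subr_ge0 // ?(ltW lp) // ler_pdivrMr // ltr_pM2r ?invr_gt0 //.
rewrite -mulrBl ler_pdivrMr // ler_pdivlMr // -exprSr.
have -> : b - digit l z e - (a - digit l z e) = b - a by ring.
move=> /(_ isT); rewrite mul1r lerBlDl ltrD2r => /(_ be altb ln); nra.
Qed.

(** An interval that avoids K lies in a scaled copy l^n ]l, z[ or
    l^n ]z + l, 1 - l[ of a main gap, or the quotient b / a of its ends is
    strictly smaller than that of a main gap.  Scaling by l does not change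
    quotients; the gaps inside the two right cylinders have at most l times
    the length of the longer main gap and do not start before z, which makes
    their quotients smaller. *)
Lemma avoids_ratio a b : avoids K a b -> 0 < a -> b <= 1 ->
  [\/ exists n, l ^+ n.+1 <= a /\ b <= l ^+ n * z,
      exists n, l ^+ n * (z + l) <= a /\ b <= l ^+ n * (1 - l),
      b * l < z * a | b * (z + l) < (1 - l) * a].
Proof.
recall_bounds; move=> ab a0 b1; have [altb|ba] := ltP a b; last by apply: Or43; nra.
have [n /ltW] := @expr_small _ l a ltac:(lra) a0.
elim: n a b ab a0 b1 altb => [|n IH] a b ab a0 b1 altb ln.
  by rewrite expr0 in ln; lra.
have aP := avoids_position ab altb (ltW a0) b1.
case: aP => [[]|[]|[e [ea be]]].
- by move=> la bz; apply: Or41; exists 0%N; rewrite expr1 expr0 mul1r.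
- by move=> la bz; apply: Or42; exists 0%N; rewrite expr0 !mul1r.
have zoom := avoids_zoom (e := e) ab.
have {}ea : 0 <= (a - digit l z e) / l by rewrite divr_ge0 ?subr_ge0 // ltW.
have {}be : (b - digit l z e) / l <= 1 by rewrite ler_pdivrMr // mul1r lerBlDl.
have aE : a = digit l z e + l * ((a - digit l z e) / l) by field; lra.
have bE : b = digit l z e + l * ((b - digit l z e) / l) by field; lra.
set a' := (a - _) / l in zoom ea aE; set b' := (b - _) / l in zoom be bE.
have [e0|e0] := eqVneq e None.
  rewrite e0 /= !add0r in aE bE.
  have a'0 : 0 < a' by nra.
  have [||[i [ai bi]]|[i [ai bi]]||] := IH _ _ zoom a'0 be.
  - by nra.
  - by rewrite aE exprS ler_pM2l in ln.
  - apply: Or41; exists i.+1.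
    by rewrite aE bE exprS [l ^+ i.+1]exprS -mulrA !ler_pM2l // -exprS.
  - apply: Or42; exists i.+1.
    by rewrite aE bE exprS -!mulrA !ler_pM2l.
  - by move=> h; apply: Or43; rewrite aE bE; nra.
  - by move=> h; apply: Or44; rewrite aE bE; nra.
have ez : z <= digit l z e by case: e e0 {zoom ea be aE bE a' b'} => [[]|] //= _; lra.
have h G g1 g2 := avoids_length (G := G) g1 g2 zoom ea be.
have za : z <= a by nra.
have bE' : b = a + l * (b' - a') by rewrite aE bE; ring.
(* compare with the longer one of the two main gaps *)
have [g12|/ltW g12] := leP (1 - 2 * l - z) (z - l).
  have {}h := h _ (lexx _) g12; apply: Or43.
  have h1 : l * l * (b' - a') <= l * l * (z - l) by rewrite ler_pM2l ?mulr_gt0.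
  have h2 : (z - l) * z <= (z - l) * a by rewrite ler_pM2l; lra.
  have h3 : l * l * (z - l) < z * (z - l) by rewrite ltr_pM2r; nra.
  by rewrite bE'; lra.
have {}h := h _ g12 (lexx _); apply: Or44; set g := 1 - 2 * l - z in h.
have g0 : 0 < g by rewrite /g; lra.
have h1 : l * (z + l) * (b' - a') <= l * (z + l) * g by rewrite ler_pM2l ?mulr_gt0 //; lra.
have h2 : g * z <= g * a by rewrite ler_pM2l.
have h3 : l * (z + l) * g < z * g by rewrite ltr_pM2r //; nra.
have -> : (1 - l) * a = g * a + a * (z + l) by rewrite /g; ring.
by rewrite bE'; lra.
Qed.

Definition max_gap_ratio : R := Num.max (z / l) ((1 - l) / (z + l)).

Lemma avoids_max_ratio a b : avoids K a b -> 0 < a -> b <= 1 -> b <= max_gap_ratio * a.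
Proof.
recall_bounds; move=> ab a0 b1.
have s1 : z / l <= max_gap_ratio by rewrite le_max lexx.
have s2 : (1 - l) / (z + l) <= max_gap_ratio by rewrite le_max lexx orbT.
have s0 : 0 <= z / l by rewrite divr_ge0; lra.
have s0' : 0 <= (1 - l) / (z + l) by rewrite divr_ge0; lra.
have le1 : z / l * a <= max_gap_ratio * a by rewrite ler_pM2r.
have le2 : (1 - l) / (z + l) * a <= max_gap_ratio * a by rewrite ler_pM2r.
case: (avoids_ratio ab a0 b1) => [[n [an bn]]|[n [an bn]]|h|h].
- apply: le_trans le1; apply: le_trans bn _.
  apply: le_trans (ler_wpM2l s0 an); rewrite exprS le_eqVlt; apply/orP; left.
  by apply/eqP; field; lra.
- apply: le_trans le2; apply: le_trans bn _.
  apply: le_trans (ler_wpM2l s0' an); rewrite le_eqVlt; apply/orP; left.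
  by apply/eqP; field; lra.
- by apply: le_trans le1; rewrite mulrAC ler_pdivlMr // ltW.
- by apply: le_trans le2; rewrite mulrAC ler_pdivlMr ?ltW //; lra.
Qed.

Lemma avoids_scale n a b : b <= z -> avoids K a b -> avoids K (l ^+ n * a) (l ^+ n * b).
Proof.
recall_bounds; move=> bz ab; elim: n => [|n IH]; first by rewrite expr0 !mul1r.
move=> x /andP[ax xb] Kx; apply: (IH (x / l)).
  by rewrite ltr_pdivlMr // ltr_pdivrMr // mulrAC -exprSr ax mulrAC -exprSr.
apply: K_unscale => //; apply: lt_le_trans xb _.
have ln0 : 0 <= l ^+ n.+1 by rewrite exprn_ge0 // ltW.
have ln1 : l ^+ n.+1 <= 1 by rewrite exprn_ile1 //; lra.
by apply: le_trans (ler_wpM2l ln0 bz) _; rewrite ler_piMl //; lra.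
Qed.

Lemma avoids_gap1 : avoids K l z.
Proof.
recall_bounds; move=> x xB /K_cover[e [y [/K01 Ky xE]]].
by case: e xE => [[]|] /= xE; nra.
Qed.

Lemma avoids_gap2 : avoids K (z + l) (1 - l).
Proof.
recall_bounds; move=> x xB /K_cover[e [y [/K01 Ky xE]]].
by case: e xE => [[]|] /= xE; nra.
Qed.

Lemma avoids_gap2_scaled : avoids K (l * (z + l)) (l * (1 - l)).
Proof.
recall_bounds; move=> x /andP[ax xb] Kx; apply: (avoids_gap2 (x := x / l)).
  by rewrite ltr_pdivlMr // ltr_pdivrMr // ![_ * l]mulrC ax.
by apply: K_unscale => //; nra.
Qed.

(** Reduce to l < s <= 1 and suppose s < 1.  The preimages under x |-> s x of the
    gaps ]l, z[ and l ]z + l, 1 - l[ avoid K.  A gap with the largest quotient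
    of its ends fits only into a scaled copy of a gap with the same quotient,
    by [avoids_ratio].  If the two main gaps have different quotients, this
    makes s a power of l.  If the quotients are equal, s exchanges the two
    kinds of gaps, and s = z + l, s^2 = l and z = s (1 - l); but the first and
    the third equation give s = 1. *)
Lemma self_scaling_expr s : 0 < s -> maps_into s 0 K K -> exists n, s = l ^+ n.
Proof.
recall_bounds; move=> s0; have [n /ltW] := @expr_small _ l s ltac:(lra) s0.
elim: n s s0 => [|n IH] s s0 ln sK.
  exists 0%N; have := K01 (sK _ K1); rewrite expr0 in ln *; lra.
have [sl|ls] := leP s l.
  have [|||m sE] := IH (s / l); rewrite ?divr_gt0 //.
  - by rewrite ler_pdivlMr // -exprSr.
  - move=> x Kx; rewrite addr0 mulrAC -[s * x]addr0; apply: K_unscale; first exact: sK.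
    by have := K01 Kx; nra.
  by exists m.+1; rewrite exprSr -sE; field; lra.
have [s1|s1] := leP 1 s.
  by exists 0%N; have := K01 (sK _ K1); rewrite expr0; lra.
exfalso.
have pull a b : avoids K a b -> avoids K (a / s) (b / s).
  move=> ab x; rewrite ltr_pdivlMr // ltr_pdivrMr // => xB /sK.
  by rewrite addr0 mulrC; apply: ab.
have zs : z <= s by have := avoids_point avoids_gap1 (sK _ K1); lra.
have pw n' : 0 < l ^+ n' <= 1 by rewrite exprn_gt0 // exprn_ile1 //; lra.
(* [A] comes from the gap ]l, z[, and [B] from l ]z + l, 1 - l[; the first
   alternative says which main gap has the larger quotient, and in the second
   one [p] is l^n s, where n is the level of the gap that contains the
   preimage. *)
have A : z * (z + l) < l * (1 - l) \/
    exists2 p, (p = s \/ p <= l * s) & p * (z + l) <= l /\ z <= p * (1 - l).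
  have [||[p [p1 p2]]|[p [p1 p2]]|h|h] := avoids_ratio (pull _ _ avoids_gap1).
  - by rewrite divr_gt0.
  - by rewrite ler_pdivrMr // mul1r.
  - move: p2; rewrite ler_pdivrMr // -mulrA.
    have /andP[_ q1] := pw p.
    have : l ^+ p * (z * s) <= z * s by rewrite ler_piMl // mulr_ge0; lra.
    by nra.
  - right; exists (l ^+ p * s).
      case: p {p1 p2} => [|p]; [left; rewrite expr0 mul1r //|right].
      by rewrite exprS -mulrA ler_pM2l //; have := pw p; nra.
    move: p1 p2; rewrite ler_pdivlMr // ler_pdivrMr // => p1 p2; split; first lra.
    by rewrite mulrAC.
  - by move: h; rewrite mulrAC mulrA ltxx.
  - left; move: h; rewrite mulrAC mulrA ltr_pM2r ?invr_gt0 //; lra.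
have B : l * (1 - l) < z * (z + l) \/
    exists2 p, (p = s \/ p <= l * s) & p <= z + l /\ l * (1 - l) <= p * z.
  have [||[p [p1 p2]]|[p [p1 p2]]|h|h] := avoids_ratio (pull _ _ avoids_gap2_scaled).
  - by rewrite divr_gt0 // mulr_gt0 //; lra.
  - by rewrite ler_pdivrMr // mul1r; nra.
  - right; exists (l ^+ p * s).
      case: p {p1 p2} => [|p]; [left; rewrite expr0 mul1r //|right].
      by rewrite exprS -mulrA ler_pM2l //; have := pw p; nra.
    move: p1 p2; rewrite ler_pdivlMr // ler_pdivrMr // => p1 p2; split.
      by move: p1; rewrite exprS -mulrA ler_pM2l.
    by rewrite mulrAC.
  - have {p1} : l ^+ p * s <= l.
      by move: p1; rewrite ler_pdivlMr // mulrAC ler_pM2r //; lra.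
    have {p2} : l <= l ^+ p * s.
      by move: p2; rewrite ler_pdivrMr // mulrAC ler_pM2r //; lra.
    case: p => [|p]; first by rewrite expr0; lra.
    have /andP[_ q1] := pw p.
    have : l ^+ p * s <= s by rewrite ler_piMl // ltW.
    by rewrite exprS -mulrA; nra.
  - left; move: h; rewrite mulrAC mulrA ltr_pM2r ?invr_gt0 //; nra.
  - by move: h; rewrite mulrAC mulrA mulrAC; nra.
by case: A => [A|[p pE [p1 p2]]]; case: B => [B|[r rE [r1 r2]]]; nra.
Qed.

(** * Words and left ends of cylinders *)

Fixpoint expand (b : letter -> R) (w : seq letter) : R :=
  if w is e :: w' then b e + l * expand b w' else 0.

Lemma expand_cat b u v :
  expand b (u ++ v) = expand b u + l ^+ size u * expand b v.
Proof.
elim: u => [|e u IH] /=; first by rewrite expr0 mul1r add0r.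
by rewrite IH exprS; ring.
Qed.

Notation val := (expand (digit l z)).

Lemma K_cyl w x : K x -> K (val w + l ^+ size w * x).
Proof.
move=> Kx; elim: w => [|e w IH] /=; first by rewrite expr0 mul1r add0r.
by congr K: (K_digit e IH); rewrite exprS; ring.
Qed.

Lemma K_val w : K (val w).
Proof. by have := K_cyl w K0; rewrite mulr0 addr0. Qed.

Lemma K_val_right w : K (val w + l ^+ size w).
Proof. by have := K_cyl w K1; rewrite mulr1. Qed.

Lemma K_cover_word n x : K x ->
  exists w y, [/\ size w = n, K y & x = val w + l ^+ n * y].
Proof.
elim: n x => [|n IH] x Kx; first by exists [::], x; rewrite expr0 mul1r add0r.
have [e [y [Ky xE]]] := K_cover Kx; have [w [y' [sw Ky' yE]]] := IH _ Ky.
by exists (e :: w), y'; split; rewrite /= ?sw // xE yE exprS; ring.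
Qed.

Definition min_gap : R := Num.min (z - l) (1 - 2 * l - z).

Lemma min_gap_bounds : [/\ 0 < min_gap, min_gap < 1,
  min_gap <= z - l & min_gap <= 1 - 2 * l - z].
Proof.
recall_bounds; rewrite /min_gap.
by case: (leP (z - l) (1 - 2 * l - z)) => ?; split; lra.
Qed.

Lemma pieces_separated e e' x y : K x -> K y ->
  `|digit l z e + l * x - (digit l z e' + l * y)| < min_gap -> e = e'.
Proof.
recall_bounds; move=> /K01 xB /K01 yB; have [g0 _ g1 g2] := min_gap_bounds.
rewrite ltr_distl => /andP[h1 h2].
by case: e h1 h2 => [[]|]; case: e' => [[]|] //= h1 h2; exfalso; nra.
Qed.

(** The cylinder of [w] is separated from the rest of K by gaps, which have at
    least the length that occurs here. *)
Lemma near_val_cyl w x : K x -> `|x - val w| < l ^+ size w * min_gap ->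
  exists2 y, K y & x = val w + l ^+ size w * y.
Proof.
recall_bounds; have [g0 _ _ _] := min_gap_bounds.
elim: w x => [|e w IH] x Kx /= xw; first by exists x => //; rewrite expr0 mul1r add0r.
have [e' [y [Ky xE]]] := K_cover Kx.
have lw1 : l ^+ (size w).+1 <= 1 by rewrite exprn_ile1 //; lra.
have ee' : e' = e.
  apply: (pieces_separated Ky (K_val w)); rewrite -xE.
  by apply: lt_le_trans xw _; rewrite ler_piMl // ltW.
have [|y' Ky' yE] := IH y Ky.
  rewrite -(ltr_pM2l lp) mulrA -exprS -[X in X * `|_|](gtr0_norm lp) -normrM.
  by congr (`|_| < _): xw; rewrite xE ee'; ring.
by exists y' => //; rewrite xE yE ee' exprS; ring.
Qed.

Lemma val_separated u v : size u = size v -> u != v ->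
  l ^+ size u <= `|val u - val v|.
Proof.
recall_bounds; elim: u v => [|e u IH] [|e' v] //= [suv].
have [<- uv|ee' _] := eqVneq e e'.
  have -> : digit l z e + l * val u - (digit l z e + l * val v) = l * (val u - val v).
    by ring.
  rewrite normrM gtr0_norm // exprS ler_pM2l //; apply: IH => //.
  by apply: contraNneq uv => ->.
have uB := K01 (K_val u); have vB := K01 (K_val v).
have uB' := K01 (K_val_right u); have vB' := K01 (K_val_right v).
rewrite -suv in vB'; rewrite exprS.
have q0 : 0 < l ^+ size u by rewrite exprn_gt0.
set q := l ^+ size u in q0 uB' vB' *; rewrite real_ler_normr ?num_real //.
by case: e ee' => [[]|]; case: e' => [[]|] //= _; apply/orP;
  first [by left; nra|by right; nra].
Qed.

(** Of the pair K, 1 - K, the set with the larger [max_gap_ratio] satisfies this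
    condition; when it is 1 - K, the theorem is applied to the mirror image of
    the union. *)
Hypothesis chiral : forall s, 0 < s -> ~ (forall x, K x -> K (s * (1 - x))).

Lemma K_right_end n x : K x -> K (1 - l ^+ n * (1 - x)).
Proof.
move=> Kx; elim: n => [|n IH]; first by rewrite expr0 mul1r subKr.
by congr K: (K_digit (Some true) IH); rewrite /= exprS; ring.
Qed.

Lemma pow_small (e : R) : 0 < e -> exists n, l ^+ n < e.
Proof. by recall_bounds; apply: expr_small; lra. Qed.

(** If x were no left end, there would be left ends of cylinders on the left of x
    at arbitrarily small distance, and their images would be points of K that
    approach [val P] from the left. *)
Lemma val_preimage r c x P : 0 < r -> maps_into r c K K -> K x ->
  r * x + c = val P -> exists w, x = val w.
Proof.
recall_bounds; have [g0 _ _ _] := min_gap_bounds.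
move=> r0 rK Kx xP.
have e0 : 0 < l ^+ size P * min_gap / r by rewrite divr_gt0 ?mulr_gt0 ?exprn_gt0.
have [n ln] := pow_small e0; rewrite ltr_pdivlMr // in ln.
have [w [y [sw Ky xE]]] := K_cover_word n Kx; have /andP[y0 y1] := K01 Ky.
have [y'0|y'0] := eqVneq y 0; first by exists w; rewrite xE y'0 mulr0 addr0.
have yp : 0 < y by rewrite lt_def y'0.
have lnp : 0 < l ^+ n by rewrite exprn_gt0.
have rv : r * val w + c - val P = - (r * (l ^+ n * y)) by rewrite -xP xE; ring.
have ryp : 0 < r * (l ^+ n * y) by rewrite !mulr_gt0.
have [|y' /K01 y'B] := near_val_cyl (w := P) (rK _ (K_val w)).
  rewrite rv normrN gtr0_norm //; apply: le_lt_trans ln; rewrite mulrCA mulrC.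
  by rewrite mulrC ler_pM2l // ler_piMr // ltW.
have : 0 <= l ^+ size P * y' by rewrite mulr_ge0 ?exprn_ge0 ?(ltW lp) //; lra.
by move: rv; lra.
Qed.

Lemma val_preimage_neg r c x P : r < 0 -> maps_into r c K K -> K x ->
  r * x + c = val P -> exists w, x = val w + l ^+ size w.
Proof.
recall_bounds; have [g0 _ _ _] := min_gap_bounds.
move=> r0 rK Kx xP; have nr0 : 0 < - r by lra.
have e0 : 0 < l ^+ size P * min_gap / - r by rewrite divr_gt0 ?mulr_gt0 ?exprn_gt0.
have [n ln] := pow_small e0; rewrite ltr_pdivlMr // in ln.
have [w [y [sw Ky xE]]] := K_cover_word n Kx; have /andP[y0 y1] := K01 Ky.
have [y'1|y'1] := eqVneq y 1; first by exists w; rewrite xE y'1 mulr1 sw.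
have yp : 0 < 1 - y by rewrite subr_gt0 lt_def eq_sym y'1.
have lnp : 0 < l ^+ n by rewrite exprn_gt0.
have rv : r * (val w + l ^+ size w) + c - val P = - (- r * (l ^+ n * (1 - y))).
  by rewrite -xP xE sw; ring.
have ryp : 0 < - r * (l ^+ n * (1 - y)) by rewrite !mulr_gt0.
have [|y' /K01 y'B] := near_val_cyl (w := P) (rK _ (K_val_right w)).
  rewrite rv normrN gtr0_norm //; apply: le_lt_trans ln.
  rewrite [l ^+ n * - r]mulrC ler_pM2l // ler_piMr //; first exact: ltW.
  by lra.
have : 0 <= l ^+ size P * y' by rewrite mulr_ge0 ?exprn_ge0 ?(ltW lp) //; lra.
by move: rv; lra.
Qed.

Lemma expr_quotient r a b : 0 < r <= 1 -> r * l ^+ a = l ^+ b ->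
  exists N, r = l ^+ N.
Proof.
recall_bounds; move=> /andP[r0 r1] E; have l1 : l < 1 by lra.
have ab : (a <= b)%N by rewrite -(ler_iXn2l lp l1) -E ler_piMl ?exprn_ge0 ?(ltW lp).
have la : l ^+ a != 0 by rewrite expf_eq0 gt_eqF // andbF.
by exists (b - a)%N; apply: (mulIf la); rewrite E -exprD subnK.
Qed.

Lemma K_scale_pow n x : K x -> K (l ^+ n * x).
Proof.
move=> Kx; have := @maps_into_iter _ l K n _ _ Kx; rewrite addr0; apply.
by move=> y /(K_digit None); rewrite addr0 add0r.
Qed.

(** After the preimage x has been recognized as an end of a cylinder, the map is
    restricted to a small cylinder at x and rescaled.  For r > 0 this gives
    s > 0 with sK in K, where s and r differ by a power of l; for r < 0 it gives
    s (1 - K) in K, which chirality excludes. *)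
Lemma covering_left_end r c x P : r != 0 -> maps_into r c K K -> K x ->
  r * x + c = val P -> (exists N, r = l ^+ N) /\ (exists w, x = val w).
Proof.
recall_bounds; have [g0 _ _ _] := min_gap_bounds.
move=> rn0 rK Kx xP.
have lP0 : 0 < l ^+ size P by rewrite exprn_gt0.
have nr0 : 0 < `|r| by rewrite normr_gt0.
have e0 : 0 < l ^+ size P * min_gap / `|r| by rewrite divr_gt0 ?mulr_gt0.
have [n] := pow_small e0; rewrite ltr_pdivlMr // mulrC => ln.
have q0 (w : seq letter) : 0 < l ^+ n * l ^+ size w by rewrite mulr_gt0 ?exprn_gt0.
have zoom (w : seq letter) k : K (x + l ^+ n * l ^+ size w * k) -> -1 <= k <= 1 ->
    K (r * (l ^+ n * l ^+ size w) / l ^+ size P * k).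
  move=> /rK Kk k1; have [|y Ky yE] := near_val_cyl (w := P) Kk.
    have -> : r * (x + l ^+ n * l ^+ size w * k) + c - val P =
      r * (l ^+ n * l ^+ size w) * k by rewrite -xP; ring.
    apply: le_lt_trans ln; rewrite 2!normrM (gtr0_norm (q0 w)) -mulrA ler_pM2l //.
    rewrite -mulrA ler_piMr ?exprn_ge0 ?(ltW lp) // mulr_ile1 ?exprn_ge0 ?(ltW lp) //.
      by rewrite exprn_ile1 //; lra.
    by rewrite ler_norml.
  congr K: Ky; apply: (mulfI (lt0r_neq0 lP0)).
  by apply: (addrI (val P)); rewrite -yE -xP; field; lra.
have r1 : r <= 1 by have := K01 (rK _ K1); have := K01 (rK _ K0); lra.
have [r0|r0] := ltP 0 r.
  have [w xE] := val_preimage r0 rK Kx xP; split; last by exists w.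
  have [|k Kk|N sE] := @self_scaling_expr (r * (l ^+ n * l ^+ size w) / l ^+ size P).
  - by rewrite divr_gt0 // mulr_gt0.
  - rewrite addr0; apply: zoom; last by have := K01 Kk; lra.
    by rewrite xE [l ^+ n * _]mulrC -mulrA; apply/K_cyl/K_scale_pow.
  apply: (@expr_quotient _ (n + size w) (size P + N)); first by rewrite r0.
  by rewrite !exprD -sE; field; lra.
have {}r0 : r < 0 by rewrite lt_neqAle rn0.
have [w xE] := val_preimage_neg r0 rK Kx xP.
case: (@chiral (- r * (l ^+ n * l ^+ size w) / l ^+ size P)).
  by rewrite divr_gt0 // mulr_gt0 // oppr_gt0.
move=> k Kk; rewrite !mulNr -mulrN; apply: zoom; last by have := K01 Kk; lra.
by congr K: (K_cyl w (K_right_end n Kk)); rewrite xE; ring.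
Qed.

(** * Uniqueness of digits *)

Lemma expand_behead b w : b None = 0 ->
  expand b w = b (head None w) + l * expand b (behead w).
Proof. by case: w => //= ->; rewrite mulr0 addr0. Qed.

Lemma expand_nseq b n w : b None = 0 ->
  expand b (nseq n None ++ w) = l ^+ n * expand b w.
Proof.
move=> b0; elim: n => [|n IH] /=; first by rewrite expr0 mul1r.
by rewrite IH b0 add0r exprS mulrA.
Qed.

Lemma expand_ext b u v : b None = 0 ->
  (forall i, nth None u i = nth None v i) -> expand b u = expand b v.
Proof.
move=> b0; have [n] := ubnP (size u + size v).
elim: n u v => // n IH u v uvn uv.
rewrite (expand_behead u b0) (expand_behead v b0) -!nth0 (uv 0%N).
have [uv0|uv0] := posnP (size u + size v).
  by case: u uv0 {uvn uv} => //; case: v.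
congr (_ + _ * _); apply: IH => [|i]; last by rewrite !nth_behead.
rewrite !size_behead; lia.
Qed.

Definition indic (p : pred letter) (e : letter) : R := (p e)%:R.

Lemma indic_expand_bounds p w : 0 <= expand (indic p) w <= 3 / 2.
Proof.
recall_bounds; elim: w => [|e w /andP[w0 w1]] /=; first by rewrite lexx /=; lra.
by rewrite /indic; case: (p e) => /=; nra.
Qed.

(** The tails contribute less than 1 to the difference of the two sides, because
    l < 1/3; so the digit sums at position 0 agree, and one can divide by l. *)
Lemma carry_free (p : pred letter) a b c d : ~~ p None ->
    expand (indic p) a + expand (indic p) b =
    expand (indic p) c + expand (indic p) d ->
  forall i, (p (nth None a i) + p (nth None b i) =
             p (nth None c i) + p (nth None d i))%N.
Proof.
recall_bounds; move=> pN E i; have b0 : indic p None = 0 by rewrite /indic (negPf pN).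
elim: i a b c d E => [|i IH] a b c d.
all: rewrite (expand_behead a b0) (expand_behead b b0).
all: rewrite (expand_behead c b0) (expand_behead d b0).
all: have := indic_expand_bounds p (behead a).
all: have := indic_expand_bounds p (behead b).
all: have := indic_expand_bounds p (behead c).
all: have := indic_expand_bounds p (behead d).
all: rewrite /indic => hd hc hb ha E.
  rewrite !nth0; move: E.
  by case: (p _) => /=; case: (p _) => /=; case: (p _) => /=; case: (p _) => //= E;
    exfalso; nra.
rewrite -!nth_behead; apply: IH; move: E.
by case: (p _) => /=; case: (p _) => /=; case: (p _) => /=; case: (p _) => //= E; nra.
Qed.

Hypothesis z_notin : ~ Qadjoin l z.

Lemma Qadjoin_closed : divring_closed (mem (Qadjoin l)).
Proof.
split=> [|x y|x y]; rewrite ?inE /Qadjoin.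
- by move=> F [[F1 _ _] _]; rewrite inE in F1.
- move=> Fx Fy F [FC FG]; have [_ FB _] := FC; rewrite -[F _]in_setE; apply: FB; rewrite inE.
    exact: Fx.
  exact: Fy.
- move=> Fx Fy F [FC FG]; have [_ _ FB] := FC; rewrite -[F _]in_setE; apply: FB; rewrite inE.
    exact: Fx.
  exact: Fy.
Qed.

Lemma Qadjoin_l : Qadjoin l l.
Proof. by move=> F [_ FG]; apply: FG; right. Qed.

Definition is_mid (e : letter) := e == Some false.
Definition is_top (e : letter) := e == Some true.

Lemma Qadjoin_expand p w : expand (indic p) w \in mem (Qadjoin l).
Proof.
have FC := Qadjoin_closed.
have [F1 FB FM] := FC.
have F0 : 0 \in mem (Qadjoin l) by rewrite -(subrr 1); exact: FB.
have FD x y : x \in mem (Qadjoin l) -> y \in mem (Qadjoin l) -> x + y \in mem (Qadjoin l).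
  by move=> Fx Fy; rewrite -[y]opprK FB // -sub0r FB.
have Fmul x y : x \in mem (Qadjoin l) -> y \in mem (Qadjoin l) -> x * y \in mem (Qadjoin l).
  by move=> Fx Fy; rewrite -[y]invrK FM // -[y^-1]mul1r FM.
elim: w => [|e w IH] //=; apply: FD.
  by rewrite /indic; case: (p e).
by apply: Fmul => //; rewrite inE; exact: Qadjoin_l.
Qed.

Lemma val_split w :
  val w = z * expand (indic is_mid) w + (1 - l) * expand (indic is_top) w.
Proof.
elim: w => [|e w IH] /=; first by rewrite !mulr0 addr0.
by rewrite IH /indic; case: e => [[]|] /=; ring.
Qed.

(** Over the field Q(l), the numbers z and 1 - l are linearly independent.  So the
    contributions of the letters 1 and of the letters 2 agree separately, and
    [carry_free] applies to both. *)
Lemma val_sum_digits a b c d : val a + val b = val c + val d ->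
  forall i p, p = is_mid \/ p = is_top ->
    (p (nth None a i) + p (nth None b i) = p (nth None c i) + p (nth None d i))%N.
Proof.
recall_bounds; rewrite !val_split.
have Q p w := Qadjoin_expand p w; have [_ FB FM] := Qadjoin_closed.
set xa := expand (indic is_mid) a; set xb := expand (indic is_mid) b.
set xc := expand (indic is_mid) c; set xd := expand (indic is_mid) d.
set ya := expand (indic is_top) a; set yb := expand (indic is_top) b.
set yc := expand (indic is_top) c; set yd := expand (indic is_top) d => E.
have EE : z * (xa - xc - (xd - xb)) = (1 - l) * (yc - ya - (yb - yd)).
  by rewrite -[RHS]addr0 -(subrr (z * xa + (1 - l) * ya + (z * xb + (1 - l) * yb))) {2}E; ring.
have xE : xa + xb = xc + xd.
  have [x0|x0] := eqVneq (xa - xc - (xd - xb)) 0; first by lra.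
  case: z_notin; have : z \in mem (Qadjoin l); last by rewrite inE.
  have -> : z = (1 - l) / ((xa - xc - (xd - xb)) / (yc - ya - (yb - yd))).
    rewrite invf_div mulrA -EE mulfK //.
  have F1 : 1 \in mem (Qadjoin l) by case: Qadjoin_closed.
  by rewrite FM // ?FM // ?FB // ?FB ?Q // inE; exact: Qadjoin_l.
have yE : ya + yb = yc + yd.
  have : (1 - l) * (yc - ya - (yb - yd)) = 0 by rewrite -EE; nra.
  by move/eqP; rewrite mulf_eq0 => /orP[]/eqP; lra.
by move=> i p [->|->]; apply: carry_free.
Qed.

Lemma val_inj_nth a b : val a = val b -> forall i, nth None a i = nth None b i.
Proof.
move=> E i; have := @val_sum_digits a [::] b [::]; rewrite /= E => /(_ erefl i) D.
have := D is_mid (or_introl erefl); have := D is_top (or_intror erefl).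
rewrite nth_nil !addn0.
by case: (nth _ a i) => [[]|]; case: (nth _ b i) => [[]|].
Qed.

(** * Copies of K with ratio a power of l *)

(** Cylinders enter through their parametrizations by K, so that the subcylinder
    in which a point lands can be read off from the first digit of [y]. *)
Definition lands N c (u w : seq letter) := forall x, K x -> exists2 y, K y &
  l ^+ N * (val w + l ^+ size w * x) + c = val u + l ^+ size u * y.

Definition letters : seq letter := [:: None; Some false; Some true].

Lemma val_rcons u e : val (rcons u e) = val u + l ^+ size u * digit l z e.
Proof. by rewrite -cats1 expand_cat /= mulr0 addr0. Qed.

(** The bound on k makes the image of the cylinder of [rcons w e] shorter than the
    distance between the subcylinders of the cylinder of [u]. *)
Lemma lands_child N c k u w e : l ^+ k < min_gap -> size w = (size u + k)%N ->
  lands N c u w -> exists e', lands N c (rcons u e') (rcons w e).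
Proof.
recall_bounds; move=> lk sw uw.
have lu0 : 0 < l ^+ size u by rewrite exprn_gt0.
have child x : K x -> exists y, [/\ K y, exists e' y', K y' /\ y = digit l z e' + l * y' &
    l ^+ N * (val (rcons w e) + l ^+ (size w).+1 * x) + c = val u + l ^+ size u * y].
  move=> Kx; have [y Ky yE] := uw _ (K_digit e Kx).
  exists y; split; [by []|exact: K_cover|].
  by rewrite -yE val_rcons exprSr; ring.
have [y0 [Ky0 [e' [y0' [Ky0' y0E]]] E0]] := child 0 K0.
exists e' => x Kx; rewrite !size_rcons.
have [y [Ky [e'' [y' [Ky' yE]]] E]] := child x Kx; exists y' => //.
have ee : e'' = e'.
  apply: (pieces_separated Ky' Ky0'); rewrite -yE -y0E.
  apply: le_lt_trans lk; rewrite -(ler_pM2l lu0) -exprD -sw.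
  rewrite -[X in X * `|_|](gtr0_norm lu0) -normrM.
  have -> : l ^+ size u * (y - y0) = l ^+ N * (l ^+ (size w).+1 * x) by lra.
  have xB := K01 Kx; have lw0 n : 0 <= l ^+ n <= 1.
    by rewrite exprn_ge0 ?exprn_ile1 //; lra.
  rewrite ger0_norm ?mulr_ge0 //; [|by case/andP: (lw0 N)|by case/andP: (lw0 (size w).+1)|lra].
  rewrite exprS -mulrA.
  have h1 : l * (l ^+ size w * x) <= l ^+ size w.
    have /andP[w0 _] := lw0 (size w).
    have : l ^+ size w * x <= l ^+ size w by rewrite ler_piMr //; lra.
    have : 0 <= l ^+ size w * x by rewrite mulr_ge0 //; lra.
    by nra.
  by apply: le_trans h1; rewrite ler_piMl ?mulr_ge0 //; have := lw0 N; have := lw0 (size w); lra.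
by rewrite E yE ee [val (rcons u _)]val_rcons exprSr; ring.
Qed.

Definition landing_family N c k (u : seq letter) (ws : seq (seq letter)) :=
  uniq ws /\ forall w, w \in ws -> size w = (size u + k)%N /\ lands N c u w.

(** The left ends of the images lie in the cylinder of [u] at mutual distances
    that are a fixed fraction of its length.  Hence the integer parts of their
    rescaled positions are different. *)
Lemma landing_family_bounded N c k u ws : landing_family N c k u ws ->
  (size ws <= (Num.truncn (l ^- (N + k))).+1)%N.
Proof.
recall_bounds; move=> [ws_uniq wsP].
have lp' n : 0 < l ^+ n by rewrite exprn_gt0.
pose pos w := (l ^+ N * val w + c - val u) / l ^+ (size u + (N + k)).
have posP w : w \in ws -> 0 <= pos w <= l ^- (N + k).
  move=> /wsP[_ /(_ _ K0)[y /K01 yB]]; rewrite mulr0 addr0 /pos => ->.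
  rewrite addrAC subrr add0r exprD -mulf_div divff ?gt_eqF // mul1r.
  by rewrite divr_ge0 ?(ltW (lp' _)) ?ler_piMl ?invr_ge0 ?(ltW (lp' _)) //; lra.
have sep : {in ws &, injective (fun w => Num.truncn (pos w))}.
  move=> w w' ww ww' tE; apply/eqP; apply: contraT => neq.
  have [sw _] := wsP _ ww; have [sw' _] := wsP _ ww'.
  have := val_separated (etrans sw (esym sw')) neq.
  have /andP[p0 _] := posP _ ww; have /andP[p0' _] := posP _ ww'.
  have := truncn_itv p0; have := truncn_itv p0'; rewrite -tE => t' t.
  have : `|pos w - pos w'| < 1.
    by rewrite ltr_distl; move: t t'; rewrite -natr1; lra.
  have -> : pos w - pos w' = l ^+ N * (val w - val w') / l ^+ (size u + (N + k)).
    by rewrite /pos -mulrBl; congr (_ / _); ring.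
  rewrite normrM normfV normrM !(gtr0_norm (lp' _)).
  rewrite ltr_pdivrMr // mul1r sw addnCA exprD ltr_pM2l // => /lt_le_trans h /h.
  by rewrite ltxx.
rewrite -(size_map (fun w => Num.truncn (pos w)) ws) -[leqRHS](size_iota 0).
apply: uniq_leq_size; first by rewrite map_inj_in_uniq.
move=> _ /mapP[w ww ->]; rewrite mem_iota add0n ltnS.
by apply: le_truncn; case/andP: (posP _ ww).
Qed.

Lemma size_le_count3 (T : Type) (p1 p2 p3 : pred T) s :
  all (fun x => [|| p1 x, p2 x | p3 x]) s ->
  (size s <= count p1 s + count p2 s + count p3 s)%N.
Proof.
elim: s => //= x s IH /andP[xP /IH].
by move: xP; case: (p1 x); case: (p2 x); case: (p3 x) => //=; lia.
Qed.

(** The three children of each of the m words give 3m words that land in the three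
    subcylinders of the cylinder of [u].  None of these can receive more than m,
    so each receives exactly m. *)
Lemma landing_family_child N c k u ws e' : l ^+ k < min_gap ->
    landing_family N c k u ws ->
    (forall u' ws', landing_family N c k u' ws' -> (size ws' <= size ws)%N) ->
  exists2 ws', landing_family N c k (rcons u e') ws' & size ws' = size ws.
Proof.
move=> lk [ws_uniq wsP] wmax.
pose cs := [seq rcons w e | w <- ws, e <- letters].
pose inside e'' (w : seq letter) := `[< lands N c (rcons u e'') w >].
have cs_uniq : uniq cs.
  rewrite allpairs_uniq // => -[w e] [w' e''] _ _ /= /eqP.
  by rewrite eqseq_rcons => /andP[/eqP-> /eqP->].
have fam e'' : landing_family N c k (rcons u e'') [seq w <- cs | inside e'' w].
  split; first exact: filter_uniq.
  move=> w; rewrite mem_filter => /andP[/asboolP uw /allpairsP[[v e] [/= vs _ wE]]].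
  by split=> //; have [sv _] := wsP _ vs; rewrite wE !size_rcons sv addSn.
have le e'' : (count (inside e'') cs <= size ws)%N.
  by rewrite -size_filter; apply: wmax (fam e'').
have tot : (size cs <= count (inside None) cs + count (inside (Some false)) cs +
                       count (inside (Some true)) cs)%N.
  apply: size_le_count3; apply/allP => w /allpairsP[[v e] [/= vs _ ->]].
  have [sv uv] := wsP _ vs; have [f ff] := lands_child e lk sv uv.
  by case: f ff => [[]|] ff; apply/or3P; [apply: Or33|apply: Or32|apply: Or31];
    apply/asboolP.
rewrite size_allpairs [size letters]/= in tot.
exists (seq.filter (inside e') cs) => //; rewrite size_filter.
have := le None; have := le (Some false); have := le (Some true).
by case: e' => [[]|]; lia.
Qed.

Lemma K_limit x : (forall e, 0 < e -> exists2 y, K y & `|x - y| < e) -> K x.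
Proof.
move=> xP; have [_ cK _] := aK.
have /closure_id -> := compact_closed (@Rhausdorff R) cK.
move=> B /nbhs_ballP[e /= e0 eB]; have [y Ky xy] := xP _ e0.
by exists y; split=> //; apply: eB.
Qed.

(** In a cylinder with a landing family of maximal size, the copy meets every
    subcylinder; being closed, it contains the left end of the cylinder. *)
Lemma embedding_meets_left_end N c : maps_into (l ^+ N) c K K ->
  exists u w, l ^+ N * val w + c = val u.
Proof.
recall_bounds; move=> hK; have [g0 _ _ _] := min_gap_bounds; have [k lk] := pow_small g0.
have lp' n : 0 < l ^+ n by rewrite exprn_gt0.
pose P m := `[< exists u ws, landing_family N c k u ws /\ size ws = m >].
have P1 : P 1%N.
  apply/asboolP; exists [::], [:: nseq k None]; split=> //; split=> // w.
  rewrite inE => /eqP->; rewrite size_nseq; split=> // x Kx.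
  exists (l ^+ N * (val (nseq k None) + l ^+ k * x) + c).
    by apply: hK; have := K_cyl (nseq k None) Kx; rewrite size_nseq.
  by rewrite /= expr0 mul1r add0r size_nseq.
have Pmax m : P m -> (m <= (Num.truncn (l ^- (N + k))).+1)%N.
  by move=> /asboolP[u [ws [uws <-]]]; exact: landing_family_bounded uws.
have [m /asboolP[u [ws [uws wsm]]] mmax] := ex_maxnP (ex_intro _ 1%N P1) Pmax.
have m0 : (0 < m)%N by exact: mmax.
have wmax u' ws' : landing_family N c k u' ws' -> (size ws' <= m)%N.
  by move=> fam; apply: mmax; apply/asboolP; exists u', ws'.
have deep n : exists2 ws', landing_family N c k (u ++ nseq n None) ws' & size ws' = m.
  elim: n => [|n [ws' fam sws']]; first by exists ws; rewrite ?cats0.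
  have [|ws2 fam2 s2] := landing_family_child None lk fam.
    by rewrite sws'; exact: wmax.
  exists ws2; last by rewrite s2.
  by rewrite -[n.+1]addn1 nseqD catA cats1.
exists u; apply: contrapT => noW.
have Kx : K ((val u - c) / l ^+ N).
  apply: K_limit => e e0.
  have e1 : 0 < l ^+ N * e by rewrite mulr_gt0.
  have [n ln] := pow_small e1; have [ws' [_ wsP] sws'] := deep n.
  case: ws' wsP sws' => [|w ws'] wsP sws'; first by rewrite -sws' in m0.
  have [sw /(_ _ K0)[y /K01 yB yE]] := wsP w (mem_head _ _).
  exists (val w); first exact: K_val.
  rewrite -(ltr_pM2l (lp' N)) -[X in X * `|_|](gtr0_norm (lp' N)) -normrM.
  have val_u : val (u ++ nseq n None) = val u.
    by rewrite expand_cat -[nseq n None]cats0 expand_nseq //= !mulr0 addr0.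
  have -> : l ^+ N * ((val u - c) / l ^+ N - val w) = - (l ^+ size (u ++ nseq n None) * y).
    have -> : l ^+ N * ((val u - c) / l ^+ N - val w) = val u - c - l ^+ N * val w.
      by field; rewrite gt_eqF.
    by move: yE; rewrite mulr0 addr0 val_u; lra.
  rewrite normrN ger0_norm ?mulr_ge0 ?(ltW (lp' _)) //; last by lra.
  apply: le_lt_trans ln; rewrite size_cat size_nseq exprD -mulrA mulrCA.
  rewrite ler_piMr ?(ltW (lp' _)) // mulr_ile1 ?(ltW (lp' _)) //; try lra.
  by rewrite exprn_ile1 //; lra.
have [||_ [w wE]] := covering_left_end (P := u) _ hK Kx.
- by rewrite gt_eqF.
- by field; rewrite gt_eqF.
by apply: noW; exists w; rewrite -wE; field; rewrite gt_eqF.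
Qed.

(** Every piece of the copy contains a left end, which yields many equations
    l^N val w + c = val u.  In such an equation the letters of [u] from position
    N on are those of [w], so that c is the value of the first N letters.
    Indeed, two distinct letters are determined by the difference of their
    digits; so it suffices to subtract an equation whose word has a letter
    different from that of [w] at the given position. *)
Lemma embedding_offset N c : maps_into (l ^+ N) c K K ->
  exists2 u, size u = N & c = val u.
Proof.
recall_bounds; move=> hK.
have dense w : exists v u, l ^+ N * val (w ++ v) + c = val u.
  have [|u [v uv]] := @embedding_meets_left_end (N + size w) (l ^+ N * val w + c).
    move=> x Kx; congr K: (hK _ (K_cyl w Kx)).
    by rewrite exprD; ring.
  by exists v, u; rewrite -uv expand_cat exprD; ring.
have [w1 [u1 E1]] := dense [::]; rewrite cat0s in E1.
have shift w2 u2 : l ^+ N * val w2 + c = val u2 -> forall i,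
    nth None w2 i <> nth None w1 i -> nth None u1 (N + i) = nth None w1 i.
  move=> E2 i neq.
  have E : val u1 + val (nseq N None ++ w2) = val u2 + val (nseq N None ++ w1).
    by rewrite !expand_nseq //; lra.
  have := val_sum_digits E (N + i); rewrite !nth_cat size_nseq ltnNge leq_addr /= addKn.
  move=> D; have := D _ (or_introl erefl); have := D _ (or_intror erefl).
  move: neq; case: (nth _ w2 i) => [[]|]; case: (nth _ w1 i) => [[]|] //;
    by case: (nth _ u1 _) => [[]|]; case: (nth _ u2 _) => [[]|].
exists (mkseq (nth None u1) N); first by rewrite size_mkseq.
have u1E : val u1 = val (mkseq (nth None u1) N ++ w1).
  apply: expand_ext => // i; rewrite nth_cat size_mkseq.
  have [iN|Ni] := ltnP i N; first by rewrite nth_mkseq.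
  rewrite -(subnKC Ni) addKn; set j := (i - N)%N.
  pose e := if nth None w1 j == None then Some true else None.
  have [v [u2 E2]] := dense (rcons (nseq j None) e).
  apply: (shift _ _ E2); rewrite nth_cat size_rcons size_nseq ltnSn.
  rewrite nth_rcons size_nseq ltnn eqxx /e.
  by case: (nth _ w1 j) => [[]|].
have := E1; rewrite u1E expand_cat size_mkseq; lra.
Qed.

(** * The union of K and a translate *)

Lemma pow_small_all (s : seq (R * R)) : (forall f, f \in s -> 0 < `|f.1|) ->
  exists k, forall f, f \in s -> l ^+ k < `|f.1|.
Proof.
recall_bounds; elim: s => [|f s IH] sP; first by exists 0%N.
have [|k kP] := IH; first by move=> g gs; apply: sP; rewrite inE gs orbT.
have [j jP] := pow_small (sP f (mem_head _ _)).
have l1 n : l ^+ n <= 1 by rewrite exprn_ile1 //; lra.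
have l0 n : 0 <= l ^+ n by rewrite exprn_ge0 // ltW.
exists (j + k)%N => g; rewrite inE => /orP[/eqP->|/kP gP].
  by apply: le_lt_trans jP; rewrite exprD ler_piMr.
by apply: le_lt_trans gP; rewrite exprD ler_piMl.
Qed.

Section Union.
Variables (t : R) (s : seq (R * R)).
Hypotheses (t_gt0 : 0 < t) (sP : is_self_similar_ifs s).
Hypothesis aX : is_attractor s (K `|` translate K t).
Notation X := (K `|` translate K t).

Let XK x : K x -> X x. Proof. by left. Qed.
Let XKt x : K x -> X (x + t). Proof. by right; exists x. Qed.

Let X_bounds x : X x -> 0 <= x <= 1 + t.
Proof.
have tp := t_gt0.
by case=> [/K01 xB|[y /K01 yB <-]]; apply/andP; split; lra.
Qed.

(** A map that covers the left end 0 of X can be restricted to a cylinder so small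
    that its image is near 0, hence in K.  Then [covering_left_end] gives the
    ratio of the map.  The map fixes 0, and its high powers push X into K. *)
Lemma union_rescales_into_K :
  exists q, forall x, X x -> K (l ^+ q * x).
Proof.
recall_bounds; have tp := t_gt0.
have XltK x : X x -> x < t -> K x.
  by case=> [//|[y /K01 yB <-]]; lra.
have [f [y [fs Xy fy]]] := attractor_cover aX (XK K0).
have [tau [x [xX Kx yE]]] : exists tau x,
    [/\ forall x, K x -> X (x + tau), K x & y = x + tau].
  case: Xy => [Ky|[x Kx <-]]; last by exists t, x.
  by exists 0, y; split=> [x Kx||]; rewrite ?addr0 //; exact: XK.
have f2y : f.2 = - (f.1 * y) by lra.
have /andP[f0 f1] := sP fs.
have [n ln] := pow_small (divr_gt0 t_gt0 f0); rewrite ltr_pdivlMr // in ln.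
have [w [k [sw Kk xE]]] := K_cover_word n Kx.
have lnp : 0 < l ^+ n by rewrite exprn_gt0.
have [|k' Kk'||[N fN] _] := @covering_left_end (f.1 * l ^+ n)
    (f.1 * (val w + tau) + f.2) k [::] _ _ Kk.
- by rewrite mulf_neq0 ?(lt0r_neq0 lnp) // -normr_gt0.
- have hE : f.1 * l ^+ n * k' + (f.1 * (val w + tau) + f.2) =
      f.1 * l ^+ n * (k' - k) by rewrite f2y yE xE; ring.
  apply: XltK.
    have := attractor_sub aX fs (xX _ (K_cyl w Kk')); congr (X _).
    by rewrite sw; ring.
  rewrite hE; apply: le_lt_trans (ler_norm _) _; apply: le_lt_trans ln.
  rewrite 2!normrM (gtr0_norm lnp) [l ^+ n * _]mulrC ler_piMr ?mulr_ge0 //.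
    by rewrite ltW.
  by rewrite ler_norml; have := K01 Kk'; have := K01 Kk; lra.
- by rewrite /= f2y yE xE; ring.
have fp : 0 < f.1 by rewrite -(pmulr_lgt0 _ lnp) fN exprn_gt0.
rewrite gtr0_norm // in f1.
have f2 : f.2 = 0.
  have := X_bounds (attractor_sub aX fs (XK K0)); have := X_bounds Xy; nra.
have [|M fM] := expr_quotient _ fN; first by rewrite fp ltW.
have lX : maps_into (l ^+ M) 0 X X.
  by move=> x' /(attractor_sub aX fs); rewrite fM f2.
have [m lm] := @expr_small _ f.1 (t / (1 + t)) ltac:(by rewrite fp) ltac:(by rewrite divr_gt0 //; lra).
rewrite ltr_pdivlMr in lm; last lra.
exists (M * m)%N => x' Xx'; rewrite exprM -fM; apply: XltK.
  by have := maps_into_iter m lX Xx'; rewrite -fM addr0.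
apply: le_lt_trans lm; rewrite ler_pM2l ?exprn_gt0 //.
by case/andP: (X_bounds Xx').
Qed.

(** The letter [d] differs from 0 because the exponent is minimal. *)
Lemma union_normal_form : exists q d u,
  [/\ d != None, l ^+ q.+1 * t = val (d :: u) &
      forall x, X x -> K (l ^+ q.+1 * x)].
Proof.
recall_bounds; have tp := t_gt0.
have exq : exists q, `[< forall x, X x -> K (l ^+ q * x) >].
  by have [q qP] := union_rescales_into_K; exists q; apply/asboolP.
have [[|q] /asboolP qP qmin] := ex_minnP exq.
  by have := K01 (qP _ (XKt K1)); rewrite expr0 mul1r; lra.
have [|[|d u] // [su] tE] := @embedding_offset q.+1 (l ^+ q.+1 * t).
  by move=> x Kx; rewrite -mulrDr; apply: qP; exact: XKt.
exists q, d, u; split=> //; apply: contraTneq (ltnSn q) => d0.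
rewrite -leqNgt; apply: qmin; apply/asboolP => x [Kx|[y Ky <-]].
  exact: K_scale_pow.
have -> : l ^+ q * (y + t) = val u + l ^+ size u * y; last exact: K_cyl.
rewrite su mulrDr addrC; congr (_ + _); apply: (mulfI (lt0r_neq0 lp)).
by rewrite mulrA -exprS tE d0 /= add0r.
Qed.

(** The boolean [b] tells which of the two copies K, K + t contains the preimage
    of [val P]. *)
Lemma map_over_left_end q P : (forall x, X x -> K (l ^+ q * x)) ->
  exists f (b : bool) w n, [/\ f \in s, (0 < n)%N, f.1 = l ^+ n &
    val P = l ^+ n * (val w + b%:R * t) + f.2].
Proof.
recall_bounds; move=> qK.
have [f [y [fs Xy fy]]] := attractor_cover aX (XK (K_val P)).
have /andP[f0 f1] := sP fs.
have lq : 0 < l ^+ q by rewrite exprn_gt0.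
have fn0 : f.1 != 0 by rewrite -normr_gt0.
have rn0 : l ^+ q * f.1 != 0 by rewrite mulf_neq0 // lt0r_neq0.
have PE : val (nseq q None ++ P) = l ^+ q * val P by rewrite expand_nseq.
have [b [w [[N fN] yE]]] : exists (b : bool) w,
    (exists N, l ^+ q * f.1 = l ^+ N) /\ y = val w + b%:R * t.
  have image (b : bool) : (forall x, K x -> X (x + b%:R * t)) ->
      maps_into (l ^+ q * f.1) (l ^+ q * (f.1 * (b%:R * t) + f.2)) K K.
    by move=> bX x /bX /(attractor_sub aX fs) /qK; congr (K _); ring.
  case: Xy => [Ky|[x Kx xy]]; [exists false|exists true].
    have [||NE [w wE]] := covering_left_end rn0 (image false _) Ky
      (P := nseq q None ++ P).
    - by move=> x Kx; rewrite mul0r addr0; exact: XK.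
    - by rewrite PE fy /=; ring.
    by exists w; rewrite -wE mul0r addr0.
  have [||NE [w wE]] := covering_left_end rn0 (image true _) Kx
    (P := nseq q None ++ P).
  - by move=> x' Kx'; rewrite mul1r; exact: XKt.
  - by rewrite PE fy -xy /=; ring.
  by exists w; rewrite -wE mul1r xy.
have fp : 0 < f.1 by rewrite -(pmulr_rgt0 _ lq) fN exprn_gt0.
rewrite gtr0_norm // in f1.
have fp1 : 0 < f.1 <= 1 by rewrite fp ltW.
have [n fE] := expr_quotient fp1 (etrans (mulrC _ _) fN).
exists f, b, w, n; split=> //; last by rewrite fy fE yE.
by rewrite lt0n; apply: contraTneq f1 => n0; rewrite fE n0 expr0 ltxx.
Qed.

Section NormalForm.
Variables (q : nat) (d : letter) (u : seq letter).
Hypotheses (d_neq0 : d != None) (tE : l ^+ q.+1 * t = val (d :: u)).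
Hypothesis qK : forall x, X x -> K (l ^+ q.+1 * x).

(** The images of K and K + t are the cylinders of [w0] and [w1] after scaling by
    l^(q+1).  As l^(q+1) t = val (d :: u), the digits of [w1] are those of [w0]
    plus those of d :: u, shifted by n; a sum of two digits is a digit only if
    no two nonzero letters meet. *)
Lemma map_digits f n : f \in s -> f.1 = l ^+ n ->
  exists w0 w1,
    [/\ size w0 = (q.+1 + n)%N /\ size w1 = (q.+1 + n)%N,
        val w0 = l ^+ q.+1 * f.2 /\ val w1 = l ^+ q.+1 * (f.1 * t + f.2),
        nth None w0 n = None /\ nth None w1 n = d &
        forall i, (i < n)%N -> nth None w1 i = nth None w0 i].
Proof.
move=> fs fE.
have h0 : maps_into (l ^+ (q.+1 + n)) (l ^+ q.+1 * f.2) K K.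
  move=> x Kx; congr K: (qK (attractor_sub aX fs (XK Kx))).
  by rewrite fE exprD; ring.
have h1 : maps_into (l ^+ (q.+1 + n)) (l ^+ q.+1 * (f.1 * t + f.2)) K K.
  move=> x Kx; congr K: (qK (attractor_sub aX fs (XKt Kx))).
  by rewrite fE exprD; ring.
have [w0 sw0 w0E] := embedding_offset h0.
have [w1 sw1 w1E] := embedding_offset h1.
have dig i p : p = is_mid \/ p = is_top ->
    (p (nth None w1 i) = p (nth None w0 i) + p (nth None (nseq n None ++ d :: u) i) :> nat)%N.
  move=> pP; have := @val_sum_digits w1 [::] w0 (nseq n None ++ d :: u) _ i p pP.
  rewrite nth_nil; have -> : p None = false by case: pP => ->.
  rewrite addn0; apply; rewrite addr0 expand_nseq // -tE -w1E -w0E fE; ring.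
exists w0, w1; split=> // [|i lin].
  have := dig n _ (or_introl erefl); have := dig n _ (or_intror erefl).
  rewrite nth_cat size_nseq ltnn subnn /=; move: d_neq0.
  by case: (d) => [[]|] //;
     case: (nth None w0 n) => [[]|]; case: (nth None w1 n) => [[]|].
have := dig i _ (or_introl erefl); have := dig i _ (or_intror erefl).
rewrite nth_cat size_nseq lin nth_nseq lin.
by case: (nth None w0 i) => [[]|]; case: (nth None w1 i) => [[]|].
Qed.

(** If the letter at position n were d, then val w would be at least
    l^n z > l^(q+1), which is too large for the first cylinder of l^(q+1) X, and
    at most l < z, which is too small for the second. *)
Lemma second_copy_position n w x : X x -> val w = l ^+ q.+1 * x ->
    (0 < n <= q)%N -> (forall i, (i < n)%N -> nth None w i = None) ->
  nth None w n <> d.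
Proof.
recall_bounds; move=> Xx wx /andP[n0 nq] w0 wd.
have wE : val w = l ^+ n * val (drop n w).
  rewrite -expand_nseq //; apply: expand_ext => // i.
  rewrite nth_cat size_nseq nth_nseq.
  by have [lin|nli] := ltnP i n; [exact: w0|rewrite nth_drop subnKC].
have zd v : z <= val (d :: v).
  have := K01 (K_val v); move: d_neq0.
  by case: (d) => [[]|] //= _; nra.
have dropE : val (drop n w) = val (d :: behead (drop n w)).
  by rewrite {1}expand_behead // -nth0 nth_drop addn0 wd.
have w_ge : l ^+ n * z <= val w by rewrite wE ler_pM2l ?exprn_gt0 // dropE.
have w_le : val w <= l.
  have vB := K01 (K_val (drop n w)).
  have aB : 0 <= l ^+ n.-1 <= 1 by rewrite exprn_ge0 ?exprn_ile1 //; lra.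
  rewrite wE -[in l ^+ n](prednK n0) exprS -mulrA ler_piMr ?(ltW lp) //.
  by rewrite mulr_ile1 //; lra.
have lqp : 0 < l ^+ q.+1 by rewrite exprn_gt0.
case: Xx wx => [/K01 xB wx|[y /K01 yB <-] wx].
  have : val w <= l ^+ q.+1 by rewrite wx ler_piMr ?(ltW lqp) //; lra.
  have : l ^+ q.+1 <= l * l ^+ n by rewrite -exprS ler_iXn2l //; lra.
  by have := exprn_gt0 n lp; nra.
have : z <= val w.
  rewrite wx mulrDr tE; apply: le_trans (zd u) _.
  by rewrite lerDr mulr_ge0 ?(ltW lqp) //; lra.
by lra.
Qed.

End NormalForm.

Lemma union_not_attractor : False.
Proof.
recall_bounds; have [q [d [u [d0 tE qK]]]] := union_normal_form.
(* [k] exceeds the exponent of every map that covers a left end, and [e] is the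
   letter other than 0 and [d] *)
have [k kP] : exists k, forall f, f \in s -> l ^+ k < `|f.1|.
  by apply: pow_small_all => f /sP/andP[].
pose e := if d == Some true then Some false else Some true.
have [e0 ed] : e != None /\ e != d by rewrite /e; move: d0; case: (d) => [[]|].
have [f [b [w [n [fs n0 fE]]]]] := map_over_left_end (nseq k e) qK.
have nk : (n < k)%N.
  have l1 : l < 1 by lra.
  have := kP _ fs; rewrite fE gtr0_norm ?exprn_gt0 //.
  by rewrite (ltr_iXn2l lp l1).
have [w0 [w1 [[sw0 sw1] [w0E w1E] [w0n w1n] w01]]] := map_digits d0 tE qK fs fE.
pose P := nseq q.+1 None ++ nseq k e; pose wb := if b then w1 else w0.
move=> PE; have {}PE : val P = val (wb ++ w).
  rewrite expand_nseq // PE expand_cat /wb; case: (b);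
    by rewrite ?sw0 ?sw1 ?w0E ?w1E ?fE exprD /=; ring.
have Pdig i : (i < q.+1 + n)%N -> nth None P i = nth None wb i.
  by move=> iqn; rewrite (val_inj_nth PE) nth_cat /wb; case: (b); rewrite ?sw0 ?sw1 iqn.
have Pn := Pdig n; rewrite {1}/P nth_cat size_nseq !nth_nseq in Pn.
have {Pn} := Pn; rewrite -[X in (X < _)%N]add0n ltn_add2r => /(_ isT).
have [nq|qn] := ltnP n q.+1; last first.
  rewrite ltn_subLR // ltn_addl // /wb.
  by case: (b); rewrite ?w0n ?w1n => /eqP; apply/negP.
move: Pdig; rewrite /wb; case: (b) => Pdig.
  by rewrite w1n => /esym/eqP; apply/negP.
move=> _; have Xft : X (f.1 * t + f.2).
  by have := attractor_sub aX fs (XKt K0); rewrite add0r.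
apply: (second_copy_position d0 tE Xft w1E _ _ w1n); first by rewrite n0.
move=> i lin; rewrite w01 // -Pdig ?ltn_addl //.
by rewrite /P nth_cat size_nseq nth_nseq (ltn_trans lin nq).
Qed.

End Union.

End ThreeMaps.

(** * Choice of the orientation *)

Lemma Qadjoin_mirror {R : realType} (l z : R) : Qadjoin l (1 - l - z) -> Qadjoin l z.
Proof.
move=> Fz; have [F1 FB _] := Qadjoin_closed l.
have Fl : l \in mem (Qadjoin l) by rewrite inE; exact: Qadjoin_l.
have -> : z = 1 - l - (1 - l - z) by ring.
suff : 1 - l - (1 - l - z) \in mem (Qadjoin l) by rewrite inE.
by apply: (FB); [exact: FB|rewrite inE].
Qed.

Lemma Qadjoin_half {R : realType} (l : R) : Qadjoin l ((1 - l) / 2).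
Proof.
have [F1 FB FM] := Qadjoin_closed l.
have Fl : l \in mem (Qadjoin l) by rewrite inE; exact: Qadjoin_l.
suff : (1 - l) / 2 \in mem (Qadjoin l) by rewrite inE.
rewrite FM ?FB //; have -> : 2 = 1 - (1 - 1 - 1) :> R by ring.
by rewrite !FB.
Qed.

Lemma mirror_three_maps {R : realType} (l z : R) K :
  is_attractor [:: (l, 0); (l, z); (l, 1 - l)] K ->
  is_attractor [:: (l, 0); (l, 1 - l - z); (l, 1 - l)] (mirror 1 K).
Proof.
move=> aK; apply: attractor_eq_mem (mirror_attractor 1 aK) => f /=.
have -> : 1 - l * 1 - 0 = 1 - l by ring.
have -> : 1 - l * 1 - z = 1 - l - z by ring.
have -> : 1 - l * 1 - (1 - l) = 0 by ring.
by rewrite !inE [LHS]orbC [X in X || _ = _]orbC -orbA.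
Qed.

(** With z' = 1 - l - z, the main gaps of K have the ratios z / l and
    (1 - l) / (z + l), and those of 1 - K the ratios z' / l and
    (1 - l) / (z' + l).  Each of the four possible equations between a ratio of
    K and one of 1 - K forces z = z', z = l or z = 1 - l. *)
Lemma max_gap_ratio_mirror_neq {R : realType} (l z : R) :
  0 < l -> l < 1 / 3 -> l < z -> z < 1 - 2 * l -> ~ Qadjoin l z ->
  max_gap_ratio l z != max_gap_ratio l (1 - l - z).
Proof.
move=> lp l3 lz z1 zQ; apply/eqP => E; apply: zQ.
suff -> : z = (1 - l) / 2 by exact: Qadjoin_half.
have cross (a b c d : R) : 0 < b -> 0 < d -> a / b = c / d -> a * d = c * b.
  by move=> b0 d0 /eqP; rewrite eqr_div ?lt0r_neq0 // => /eqP.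
by move: E; rewrite /max_gap_ratio; case: leP => _; case: leP => _;
  move/cross => /(_ ltac:(lra) ltac:(lra)); nra.
Qed.

(** If s (1 - K) is contained in K, then each gap of K near 0 pulls back to an
    interval that avoids 1 - K, so its ratio is at most the largest one of
    1 - K. *)
Lemma max_gap_ratio_chiral {R : realType} (l z : R) K :
  0 < l -> l < 1 / 3 -> l < z -> z < 1 - 2 * l ->
  is_attractor [:: (l, 0); (l, z); (l, 1 - l)] K ->
  max_gap_ratio l (1 - l - z) < max_gap_ratio l z ->
  forall s, 0 < s -> ~ (forall x, K x -> K (s * (1 - x))).
Proof.
move=> lp l3 lz z1 aK sp s s0 sK; move: sp; rewrite ltNge; apply/negP; rewrite negbK.
have aK' := mirror_three_maps aK.
have [n] := @expr_small _ l s ltac:(lra) s0; set q := l ^+ n => qs.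
have q0 : 0 < q by rewrite exprn_gt0.
have lz' : l < 1 - l - z by lra.
have z1' : 1 - l - z < 1 - 2 * l by lra.
have gap a b : 0 < a -> b <= 1 -> avoids K (q * a) (q * b) ->
    b <= max_gap_ratio l (1 - l - z) * a.
  move=> a0 b1 ab.
  have ab' : avoids (mirror 1 K) (q * a / s) (q * b / s).
    move=> x; rewrite ltr_pdivrMr // ltr_pdivlMr // => xB /mirrorE /sK.
    by rewrite subKr mulrC; exact: ab.
  have := avoids_max_ratio lp l3 lz' z1' aK' ab'.
  rewrite mulrA ler_pM2r ?invr_gt0 // mulrCA ler_pM2l //; apply.
    by rewrite divr_gt0 ?mulr_gt0.
  by rewrite ler_pdivrMr // mul1r; nra.
rewrite /max_gap_ratio ge_max; apply/andP; split.
  rewrite ler_pdivrMr //; apply: gap => //; first by lra.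
  by apply: (avoids_scale lp l3 lz z1 aK) => //; exact: (avoids_gap1 lp l3 lz z1 aK).
rewrite ler_pdivrMr; last by lra.
have gap2 := avoids_gap2_scaled lp l3 lz z1 aK.
have : l * (1 - l) <= max_gap_ratio l (1 - l - z) * (l * (z + l)).
  apply: gap; [by rewrite mulr_gt0 //; lra|by nra|].
  by apply: (avoids_scale lp l3 lz z1 aK _ gap2); nra.
by rewrite mulrCA ler_pM2l.
Qed.

Lemma three_maps_union_not_self_similar {R : realType} (l z : R) K t :
  0 < l -> l < 1 / 3 -> l < z -> z < 1 - 2 * l ->
  is_attractor [:: (l, 0); (l, z); (l, 1 - l)] K ->
  ~ Qadjoin l z -> 0 < t -> ~ self_similar_set (K `|` translate K t).
Proof.
move=> lp l3 lz z1 aK zQ t0 [[s [sP aX]] _].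
have [sp|sp|/eqP sp] := ltgtP (max_gap_ratio l z) (max_gap_ratio l (1 - l - z)).
- have aK' := mirror_three_maps aK.
  have zz : 1 - l - (1 - l - z) = z by ring.
  have lz' : l < 1 - l - z by lra.
  have z1' : 1 - l - z < 1 - 2 * l by lra.
  have chi : forall s, 0 < s -> ~ (forall x, mirror 1 K x -> mirror 1 K (s * (1 - x))).
    by apply: max_gap_ratio_chiral lz' z1' aK' _ => //; rewrite zz.
  have aX' := mirror_attractor (1 + t) aX.
  have XE : mirror (1 + t) (K `|` translate K t) =
            mirror 1 K `|` translate (mirror 1 K) t.
    apply/seteqP; split=> [x /mirrorE[Kx|[y Ky yE]]|x [/mirrorE Kx|[y /mirrorE Ky <-]]].
    - right; exists (x - t); last by rewrite subrK.
      by apply/mirrorE; congr K: Kx; ring.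
    - by left; apply/mirrorE; congr K: Ky; lra.
    - by apply/mirrorE; right; exists (1 - x) => //; ring.
    - by apply/mirrorE; left; congr K: Ky; ring.
  rewrite XE in aX'.
  apply: (union_not_attractor lp l3 lz' z1' aK' chi _ t0 _ aX').
    by move=> /Qadjoin_mirror.
  by move=> _ /mapP[f /sP fs ->].
- have chi := max_gap_ratio_chiral lp l3 lz z1 aK sp.
  exact: (union_not_attractor lp l3 lz z1 aK chi zQ t0 sP aX).
- by move: sp; apply/negP; exact: max_gap_ratio_mirror_neq.
Qed.

Theorem theorem1p9 (R : realType) :
  (forall (l0 l1 : R) (K : set R),
     0 < l0 -> 0 < l1 -> l0 + l1 < 1 ->
     is_attractor [:: (l0, 0); (l1, 1 - l1)] K ->
     ~ rational (ln l0 / ln l1) ->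
     forall (m : nat) (t : 'rV[R]_m.+1),
       (1 <= m)%N ->
       t ord0 ord0 = 0 ->
       (forall i j : 'I_m.+1, (i < j)%N -> t ord0 i < t ord0 j) ->
       ~ self_similar_set
           (\bigcup_(j in [set: 'I_m.+1]) translate K (t ord0 j)))
  /\
  (forall (l z : R) (K : set R),
     0 < l -> l < 1 / 3 -> l < z -> z < 1 - 2 * l ->
     is_attractor [:: (l, 0); (l, z); (l, 1 - l)] K ->
     ~ Qadjoin l z ->
     forall t : R, 0 < t ->
       ~ self_similar_set (K `|` translate K t)).

Proof.
split=> [l0 l1 K l0p l1p l01 aK irr m t m1 t0 tmono|l z K lp l3 lz z1 aK zQ t t0].
  exact: (two_maps_translates_not_self_similar l0p l1p l01 aK irr m1 t0 tmono).
exact: (three_maps_union_not_self_similar lp l3 lz z1 aK zQ t0).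
Qed.
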